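(* Let $(\rho_h,\theta_h,\eta_h)\in\Pi^1_c(\mathcal I_\tau;\mathcal V_h\times\mathcal V_h^+\times\mathcal V_h)$, $(\mu_{\rho,h},\mu_{\eta,h})\in\Pi^0(\mathcal I_\tau;\mathcal V_h\times\mathcal V_h)$ be a solution of the fully discrete problem: $(\rho_h^0,\theta_h^0,\eta_h^0)=(\rho_{0,h},\theta_{0,h},\eta_{0,h})\in\mathcal V_h\times\mathcal V_h^+\times\mathcal V_h$ given, and for all $v_{1,h},v_{2,h},\xi_h,w_{1,h},w_{2,h}\in\mathcal V_h$ and all time steps $n\ge0$, \begin{align*} &\langle d_\tau^{n+1}\rho_h,v_{1,h}\rangle+\langle\mathbf L_{11}\nabla\mu_{\rho,h}^{n+1}-\mathbf L_{12}\nabla\theta_h^{n+1}+\mu_{\eta,h}^{n+1}\mathbf L_{13},\nabla v_{1,h}\rangle=0,\\ &\langle\mu_{\rho,h}^{n+1},v_{2,h}\rangle-\gamma_\rho\langle\nabla\rho_h^{n+1},\nabla v_{2,h}\rangle-\langle\partial_\rho\psi_{vex}(\rho_h^{n+1},\theta_h^{n+1},\eta_h^{n+1})+\partial_\rho\psi_{cav}(\rho_h^n,\theta_h^{n+1},\eta_h^n),v_{2,h}\rangle=0,\\ &\langle d_\tau^{n+1}e(\rho_h,\theta_h,\eta_h),\xi_h\rangle+\langle\mathbf L_{12}\nabla\mu_{\rho,h}^{n+1}-\mathbf L_{22}\nabla\theta_h^{n+1}+\mu_{\eta,h}^{n+1}\mathbf L_{23},\nabla\xi_h\rangle=0,\\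 &\langle d_\tau^{n+1}\eta_h,w_{1,h}\rangle+\langle\mathbf L_{13}\cdot\nabla\mu_{\rho,h}^{n+1}-\mathbf L_{23}\cdot\nabla\theta_h^{n+1}+\mathbf L_{33}\mu_{\eta,h}^{n+1},w_{1,h}\rangle=0,\\ &\langle\mu_{\eta,h}^{n+1},w_{2,h}\rangle-\gamma_\eta\langle\nabla\eta_h^{n+1},\nabla w_{2,h}\rangle-\langle\partial_\eta\psi_{vex}(\rho_h^{n+1},\theta_h^{n+1},\eta_h^{n+1})+\partial_\eta\psi_{cav}(\rho_h^n,\theta_h^{n+1},\eta_h^n),w_{2,h}\rangle=0. \end{align*} Write $e_h^n=e(\rho_h^n,\theta_h^n,\eta_h^n)$, $s_h^n=s(\rho_h^n,\theta_h^n,\eta_h^n)$. Then for all time steps $n\ge0$ $$\langle\rho_h^{n+1},1\rangle=\langle\rho_h^0,1\rangle,\qquad\langle e_h^{n+1},1\rangle=\langle e_h^0,1\rangle,$$ $$\langle s_h^{n+1},1\rangle=\langle s_h^0,1\rangle+\sum_{k=0}^{n}\mathcal D^k_{num}(\rho_h,\theta_h,\eta_h)+\tau\sum_{k=0}^{n}\mathcal D_{\mathbf L}(\mu_{\rho,h}^{k+1},\theta_h^{k+1},\mu_{\eta,h}^{k+1}),$$ where the numerical dissipation is \begin{align*} \mathcal D^n_{num}(\rho_h,\theta_h,\eta_h)=&\ \tfrac{\gamma_\rho}2\|\nabla d^{n+1}\rho_h\|_{L^2}^2+\tfrac{\gamma_\eta}2\|\nabla d^{n+1}\eta_h\|_{L^2}^2-\tfrac12\langle\partial_{\theta\theta}\psi(\rho_h^n,\xi_1,\eta_h^n)\,d^{n+1}\theta_h,d^{n+1}\theta_h\rangle\\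 &-\tfrac12\big\langle\big(H^{cav}(\chi_1,\theta_h^{n+1},\chi_2)-H^{vex}(\chi_3,\theta_h^{n+1},\chi_4)\big)d^{n+1}(\rho_h,\eta_h)^\top,d^{n+1}(\rho_h,\eta_h)^\top\big\rangle\ \ge 0 \end{align*} for some functions $\xi_1$ with values between $\theta_h^n$ and $\theta_h^{n+1}$, $\chi_1,\chi_3$ with values between $\rho_h^n$ and $\rho_h^{n+1}$, and $\chi_2,\chi_4$ with values between $\eta_h^n$ and $\eta_h^{n+1}$ (pointwise in $\Omega$).
   Context: Domain: $\Omega\subset\mathbb R^d$, $d\in\{2,3\}$, is a cube identified with the $d$-dimensional torus; all functions on $\Omega$ are periodic. $\langle\cdot,\cdot\rangle$ is the $L^2(\Omega)$ inner product. Finite elements: $\mathcal T_h$ is a geometrically conforming partition of $\Omega$ into simplices which can be extended periodically; $\mathcal V_h$ is the space of continuous (periodic) functions that are affine on each $K\in\mathcal T_h$, and $\mathcal V_h^+=\{v\in\mathcal V_h: v(x)>0\ \forall x\in\Omega\}$. Time grid: $\mathcal I_\tau=\{0=t^0,t^1=\tau,\dots,t^{n_T}=T\}$ uniform, $n_T=T/\tau$; time steps $n$ range over $0\le n\le n_T-1$. $\Pi^1_c(\mathcal I_\tau;X)$, $\Pi^0(\mathcal I_\tau;X)$ are continuous piecewise linear, respectively piecewise constant, functions on the grid with values in $X$; $g^n=g(t^n)$ for $g\in\Pi^1_c$, and $g^{n+1}$ is the value on $(t^n,t^{n+1}]$ for $g\in\Pi^0$. $d^{n+1}g=g^{n+1}-g^n$,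 $d_\tau^{n+1}g=(g^{n+1}-g^n)/\tau$; in particular $d_\tau^{n+1}e(\rho_h,\theta_h,\eta_h)=(e_h^{n+1}-e_h^n)/\tau$. Parameters: $\gamma_\rho,\gamma_\eta>0$. Mobility: $\mathbf L_{11},\mathbf L_{12},\mathbf L_{22}$ are $d\times d$-matrix valued, $\mathbf L_{13},\mathbf L_{23}$ are $\mathbb R^d$-valued and $\mathbf L_{33}$ is scalar; all are functions of $(\rho,\nabla\rho,\theta,\eta,\nabla\eta)$, and in the scheme they may be evaluated at any linear combination of the old ($t^n$) and new ($t^{n+1}$) time levels of the discrete solution. The matrix $$\mathbf L=\begin{pmatrix}\mathbf L_{11}&-\mathbf L_{12}&\mathbf L_{13}\\-\mathbf L_{12}&\mathbf L_{22}&-\mathbf L_{23}\\ \mathbf L_{13}^\top&-\mathbf L_{23}^\top&\mathbf L_{33}\end{pmatrix}\in\mathbb R^{(2d+1)\times(2d+1)}$$ satisfies $\lambda_0|\xi|^2\le\xi^\top\mathbf L\xi\le\lambda_1|\xi|^2$ for all $\xi\in\mathbb R^{2d+1}$ with constants $\lambda_0,\lambda_1>0$; every component of $\mathbf L$ is $C^1$ in all arguments with first partial derivatives bounded by a constant. Define $\mathcal D_{\mathbf L}(\mu_\rho,\theta,\mu_\eta)=\int_\Omega (\nabla\mu_\rho,\nabla\theta,\mu_\eta)\,\mathbf L\,(\nabla\mu_\rho,\nabla\theta,\mu_\eta)^\top dx$, with $\mathbf L$ evaluated as in the corresponding time step of the scheme. Potential: $\psi:\mathbb R\times(0,\infty)\times\mathbb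 R\to\mathbb R$, $(\rho,\theta,\eta)\mapsto\psi(\rho,\theta,\eta)$, is smooth; for every fixed $(\rho,\eta)$, $\psi(\rho,\cdot,\eta)$ is concave with $\psi(\rho,\theta,\eta)\to-\infty$ as $\theta\to0^+$; for every fixed $\theta>0$, $\psi(\cdot,\theta,\cdot)=\psi_{vex}(\cdot,\theta,\cdot)+\psi_{cav}(\cdot,\theta,\cdot)$ with $\psi_{vex}$ convex and $\psi_{cav}$ concave in $(\rho,\eta)$ (both smooth). $H^{vex}$, $H^{cav}$ denote the $2\times2$ Hessians of $\psi_{vex}$, $\psi_{cav}$ with respect to $(\rho,\eta)$. There is $\alpha\in\mathbb R$ such that $(\rho,\eta)\mapsto\psi(\rho,\theta,\eta)+\frac\alpha2(\rho^2+\eta^2)$ is strictly convex for every fixed $\theta>0$. Here $\theta$ is the inverse temperature. Internal energy and entropy densities: $e(\rho,\theta,\eta)=\partial_\theta\psi(\rho,\theta,\eta)$ and $s(\rho,\theta,\eta)=\theta\,\partial_\theta\psi(\rho,\theta,\eta)-\psi(\rho,\theta,\eta)-\frac{\gamma_\rho}2|\nabla\rho|^2-\frac{\gamma_\eta}2|\nabla\eta|^2$. *)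

(* Defs.v *)
From HB Require Import structures.
From mathcomp Require Import all_boot all_order all_algebra.
From mathcomp Require Import all_classical all_reals all_analysis.

Set Implicit Arguments.
Unset Strict Implicit.
Unset Printing Implicit Defensive.

Import Order.TTheory GRing.Theory Num.Theory.
Import numFieldNormedType.Exports.

Local Open Scope classical_set_scope.
Local Open Scope ring_scope.

(* Points of R^d are row vectors, so that the results on compact sets of
   'rV[R]_d apply; gradients and fluxes are column vectors. *)

(* The product measure of the library, registered again as a sigma-finite
   measure so that products can be iterated. *)
Section SigmaFiniteProduct.
Context {d1 d2 : measure_display} {T1 : measurableType d1}
  {T2 : measurableType d2} {R : realType}.
Variables (m1 : {sigma_finite_measure set T1 -> \bar R})
  (m2 : {sigma_finite_measure set T2 -> \bar R}).

Definition sf_product : set (T1 * T2)%type -> \bar R := (m1 \x m2)%E.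

HB.instance Definition _ := Measure.on sf_product.

Fact sf_product_sigma_finite : sigma_finite setT sf_product.
Proof.
have /sigma_finiteP[F [TF ndF Foo]] := sigma_finiteT m1.
have /sigma_finiteP[G [TG ndG Goo]] := sigma_finiteT m2.
exists (fun n => F n `*` G n).
  rewrite -setXTT TF TG predeqE => -[x y]; split.
    move=> [/= [n _ Fnx] [k _ Gky]]; exists (maxn n k) => //; split.
    - by move: x Fnx; exact/subsetPset/ndF/leq_maxl.
    - by move: y Gky; exact/subsetPset/ndG/leq_maxr.
  by move=> [n _ []/= ? ?]; split; exists n.
move=> k; have [? ?] := Foo k; have [? ?] := Goo k.
split; first exact: measurableX.
by rewrite /sf_product product_measure1E// lte_mul_pinfty// ge0_fin_numE.
Qed.

HB.instance Definition _ :=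
  Measure_isSigmaFinite.Build _ _ _ sf_product sf_product_sigma_finite.

End SigmaFiniteProduct.

Section Integral.
Context {R : realType}.

(* The library has binary product measures only: Lebesgue measure on R^n is
   built on the nested product R * (R * ... * unit). *)
Record measureSpace := MeasureSpace {
  ms_disp : measure_display;
  ms_type : measurableType ms_disp;
  ms_measure : {sigma_finite_measure set ms_type -> \bar R} }.

Fixpoint lebesgueSpace (n : nat) : measureSpace :=
  match n with
  | 0 => @MeasureSpace _ unit (@dirac _ unit tt R)
  | m.+1 => @MeasureSpace _ (measurableTypeR R * ms_type (lebesgueSpace m))%type
      (sf_product (@lebesgue_measure R) (ms_measure (lebesgueSpace m)))
  end.

Fixpoint coord (n : nat) : ms_type (lebesgueSpace n) -> nat -> R :=
  match n with
  | 0 => fun _ _ => 0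
  | m.+1 => fun x i => match i with 0 => x.1 | j.+1 => coord x.2 j end
  end.

Definition to_rV (n : nat) (x : ms_type (lebesgueSpace n)) : 'rV[R]_n :=
  \row_i coord x i.

Definition integral_on (n : nat) (D : set 'rV[R]_n) (f : 'rV[R]_n -> R) : R :=
  \int[ms_measure (lebesgueSpace n)]_(x in @to_rV n @^-1` D) f (to_rV x).

Definition integrable_on (n : nat) (D : set 'rV[R]_n) (f : 'rV[R]_n -> R) :
  Prop :=
  (ms_measure (lebesgueSpace n)).-integrable (@to_rV n @^-1` D)
    (fun x => (f (to_rV x))%:E).

End Integral.

Section Calculus.
Context {R : realType}.

(* [f] is k times continuously differentiable on the open set [U], [E] being
   the set of coordinate directions of [V]. *)
Fixpoint Ck (V : normedModType R) (E U : set V) (k : nat) (f : V -> R) : Prop :=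
  (forall x, U x -> {for x, continuous f}) /\
  match k with
  | 0 => True
  | j.+1 => forall v, E v ->
      (forall x, U x -> derivable f x v) /\ Ck E U j ('D_v f)
  end.

Definition smooth (V : normedModType R) (E U : set V) (f : V -> R) : Prop :=
  forall k, Ck E U k f.

Definition strictly_convex (V : lmodType R) (f : V -> R) : Prop :=
  forall x y t, x != y -> 0 < t < 1 ->
    f (t *: x + (1 - t) *: y) < t * f x + (1 - t) * f y.

Definition dot (n : nat) (u v : 'cV[R]_n) : R := (u^T *m v) 0 0.

(* Only evaluated almost everywhere for finite element functions: at points of
   element faces the partial derivatives need not exist, and ['D] is then the
   library's default value. *)
Definition grad (n : nat) (v : 'rV[R]_n -> R) (x : 'rV[R]_n) : 'cV[R]_n :=
  \col_i 'D_(delta_mx 0 i) v x.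

Definition between (a b c : R) : Prop := Num.min a b <= c <= Num.max a b.

End Calculus.

Section FiniteElements.
Context {R : realType} {d : nat}.
Variables (a : 'rV[R]_d) (l : R).

Definition cube : set 'rV[R]_d :=
  [set x | forall i, a 0 i <= x 0 i <= a 0 i + l].

Definition lattice_vector (k : 'I_d -> int) : 'rV[R]_d :=
  \row_i (l * (k i)%:~R).

Definition periodic (v : 'rV[R]_d -> R) : Prop :=
  forall x k, v (x + lattice_vector k) = v x.

Definition affinely_independent (p : 'I_d.+1 -> 'rV[R]_d) : Prop :=
  forall w : 'I_d.+1 -> R,
    \sum_i w i = 0 -> \sum_i w i *: p i = 0 -> forall i, w i = 0.

(* Convex hull of the points [p i], [i] in [A]; empty if [A] is. *)
Definition hull (p : 'I_d.+1 -> 'rV[R]_d) (A : set 'I_d.+1) : set 'rV[R]_d :=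
  [set x | exists w : 'I_d.+1 -> R,
    [/\ forall i, 0 <= w i, forall i, ~ A i -> w i = 0,
        \sum_i w i = 1 & x = \sum_i w i *: p i]].

Record mesh := Mesh {
  cell : finType;
  vertex : cell -> 'I_d.+1 -> 'rV[R]_d }.

Definition simplex (T : mesh) (K : cell T) : set 'rV[R]_d :=
  hull (@vertex T K) setT.

(* The conformity condition ranges over all periodic translates of [K'];
   the zero translate gives conformity inside the cube. *)
Definition conforming_periodic_triangulation (T : mesh) : Prop :=
  [/\ forall K : cell T, affinely_independent (@vertex T K),
      \bigcup_(K in [set: cell T]) simplex K = cube,
      forall K K' : cell T, K != K' ->
        interior (simplex K) `&` interior (simplex K') = set0 &
      forall (K K' : cell T) (k : 'I_d -> int),
        simplex K `&` [set x + lattice_vector k | x in simplex K'] =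
        hull (@vertex T K)
          [set i | exists j, vertex K i = vertex K' j + lattice_vector k]].

Definition Vh (T : mesh) : set ('rV[R]_d -> R) :=
  [set v | [/\ periodic v, continuous v &
    forall K : cell T, exists (g : 'cV[R]_d) (c : R),
      forall x, simplex K x -> v x = (x *m g) 0 0 + c]].

Definition Vh_pos (T : mesh) : set ('rV[R]_d -> R) :=
  [set v | Vh T v /\ forall x, cube x -> 0 < v x].

Definition ip (f g : 'rV[R]_d -> R) : R :=
  integral_on cube (fun x => f x * g x).

Definition ipv (F G : 'rV[R]_d -> 'cV[R]_d) : R :=
  integral_on cube (fun x => dot (F x) (G x)).

End FiniteElements.

Section TimeGrid.
Context {R : realType} {Y : Type}.
Variables (tau : R) (nT : nat) (X : set (Y -> R)).

(* Value of a space-time function at the grid point t^n = n tau. *)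
Definition lev (g : R -> Y -> R) (n : nat) : Y -> R := g (n%:R * tau).

Definition Pi1c (g : R -> Y -> R) : Prop :=
  (forall t, 0 <= t <= nT%:R * tau -> X (g t)) /\
  forall n s y, (n < nT)%N -> 0 <= s <= 1 ->
    g ((n%:R + s) * tau) y = (1 - s) * lev g n y + s * lev g n.+1 y.

Definition Pi0 (g : R -> Y -> R) : Prop :=
  (forall t, 0 < t <= nT%:R * tau -> X (g t)) /\
  forall n t, (n < nT)%N -> n%:R * tau < t <= n.+1%:R * tau ->
    g t = lev g n.+1.

Definition dlev (g : R -> Y -> R) (n : nat) : Y -> R :=
  fun y => lev g n.+1 y - lev g n y.

End TimeGrid.

Section Potential.
Context {R : realType}.

(* Thermodynamic states (rho, theta, eta). *)
Definition state : normedModType R := (R * R * R)%type.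

Definition dir_rho : state := (1, 0, 0).
Definition dir_theta : state := (0, 1, 0).
Definition dir_eta : state := (0, 0, 1).

Definition positive_temperature : set state := [set z | 0 < z.1.2].

Definition smooth_potential (psi : state -> R) : Prop :=
  smooth [set dir_rho; dir_theta; dir_eta] positive_temperature psi.

Definition concave_in_theta (psi : state -> R) : Prop :=
  forall r e : R,
    convex_function (E := R^o) [set th | 0 < th] (fun th => - psi (r, th, e)).

Definition convex_in_rho_eta (psi : state -> R) : Prop :=
  forall th : R, 0 < th ->
    convex_function (E := (R^o * R^o)%type) setT
      (fun z => psi (z.1, th, z.2)).

Definition d_rho (psi : state -> R) : state -> R := 'D_dir_rho psi.
Definition d_theta (psi : state -> R) : state -> R := 'D_dir_theta psi.
Definition d_eta (psi : state -> R) : state -> R := 'D_dir_eta psi.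

(* 2 x 2 Hessian with respect to (rho, eta). *)
Definition hessian (psi : state -> R) (z : state) : 'M[R]_2 :=
  let dir (i : 'I_2) := if i == 0 then dir_rho else dir_eta in
  \matrix_(i, j) 'D_(dir j) ('D_(dir i) psi) z.

Definition admissible_potential (psi psi_vex psi_cav : state -> R) : Prop :=
  [/\ [/\ smooth_potential psi, smooth_potential psi_vex &
          smooth_potential psi_cav],
      concave_in_theta psi,
      forall r e : R, psi (r, th, e) @[th --> 0^'+] --> -oo,
      [/\ forall z, positive_temperature z -> psi z = psi_vex z + psi_cav z,
          convex_in_rho_eta psi_vex &
          convex_in_rho_eta (fun z => - psi_cav z)] &
      exists alpha : R, forall th : R, 0 < th ->
        strictly_convex (V := (R^o * R^o)%type)
          (fun z => psi (z.1, th, z.2) + alpha / 2 * (z.1 ^+ 2 + z.2 ^+ 2))].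

End Potential.

Section Mobility.
Context {R : realType} {d : nat}.

(* Arguments (rho, grad rho, theta, eta, grad eta). *)
Definition mob_arg : normedModType R :=
  (R * 'cV[R]_d * R * R * 'cV[R]_d)%type.

Record mobility := Mobility {
  L11 : mob_arg -> 'M[R]_d;
  L12 : mob_arg -> 'M[R]_d;
  L13 : mob_arg -> 'cV[R]_d;
  L22 : mob_arg -> 'M[R]_d;
  L23 : mob_arg -> 'cV[R]_d;
  L33 : mob_arg -> R }.

Definition mob_matrix (L : mobility) (z : mob_arg) : 'M[R]_(d + d + 1) :=
  block_mx
    (block_mx (L11 L z) (- L12 L z) (- L12 L z) (L22 L z))
    (col_mx (L13 L z) (- L23 L z))
    (row_mx (L13 L z)^T (- (L23 L z)^T))
    (L33 L z)%:M.

Definition mob_dirs : set mob_arg :=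
  [set v | v = (1, 0, 0, 0, 0) \/
           (exists i, v = (0, delta_mx i 0, 0, 0, 0)) \/
           v = (0, 0, 1, 0, 0) \/
           v = (0, 0, 0, 1, 0) \/
           (exists i, v = (0, 0, 0, 0, delta_mx i 0))].

Definition admissible_mobility (L : mobility) (lam0 lam1 : R) : Prop :=
  [/\ 0 < lam0, 0 < lam1,
      forall (z : mob_arg) (xi : 'cV[R]_(d + d + 1)),
        lam0 * dot xi xi <= dot xi (mob_matrix L z *m xi) <= lam1 * dot xi xi,
      forall i j, Ck mob_dirs setT 1 (fun z => mob_matrix L z i j) &
      exists C : R, forall i j v z, mob_dirs v ->
        `|'D_v (fun z => mob_matrix L z i j) z| <= C].

End Mobility.

Section Scheme.
Context {R : realType} {d : nat}.
Variables (a : 'rV[R]_d) (l : R) (T : @mesh R d).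
Variables (tau gamma_rho gamma_eta : R).
Variables (psi psi_vex psi_cav : @state R -> R).
Variables (L : @mobility R d).

(* Weights, for each of the five arguments of the mobility, of the old and of
   the new time level. *)
Variables (w_old w_new : 'I_5 -> R).

Variables (rho theta eta mu_rho mu_eta : R -> 'rV[R]_d -> R).

Definition state_at (n : nat) (x : 'rV[R]_d) : @state R :=
  (lev tau rho n x, lev tau theta n x, lev tau eta n x).

Definition energy (n : nat) (x : 'rV[R]_d) : R := d_theta psi (state_at n x).

Definition entropy (n : nat) (x : 'rV[R]_d) : R :=
  lev tau theta n x * d_theta psi (state_at n x) - psi (state_at n x)
  - gamma_rho / 2 * dot (grad (lev tau rho n) x) (grad (lev tau rho n) x)
  - gamma_eta / 2 * dot (grad (lev tau eta n) x) (grad (lev tau eta n) x).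

Definition mob_arg_at (n : nat) (x : 'rV[R]_d) : @mob_arg R d :=
  let comb (V : lmodType R) (i : 'I_5) (f : nat -> V) :=
    w_old i *: f n + w_new i *: f n.+1 in
  (comb R^o (inord 0) (fun m => lev tau rho m x),
   comb 'cV[R]_d (inord 1) (fun m => grad (lev tau rho m) x),
   comb R^o (inord 2) (fun m => lev tau theta m x),
   comb R^o (inord 3) (fun m => lev tau eta m x),
   comb 'cV[R]_d (inord 4) (fun m => grad (lev tau eta m) x)).

Definition scheme_step (n : nat) : Prop :=
  let z := mob_arg_at n in
  let mr := lev tau mu_rho n.+1 in
  let me := lev tau mu_eta n.+1 in
  let th := lev tau theta n.+1 in
  let new := state_at n.+1 in
  let mixed x := (lev tau rho n x, lev tau theta n.+1 x, lev tau eta n x) in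
  let ip := ip a l in
  let ipv := ipv a l in
  forall v1 v2 xi w1 w2, Vh l T v1 -> Vh l T v2 -> Vh l T xi ->
    Vh l T w1 -> Vh l T w2 ->
  [/\ ip (fun x => dlev tau rho n x / tau) v1
      + ipv (fun x => L11 L (z x) *m grad mr x - L12 L (z x) *m grad th x
                      + me x *: L13 L (z x)) (grad v1) = 0,
      ip mr v2 - gamma_rho * ipv (grad (lev tau rho n.+1)) (grad v2)
      - ip (fun x => d_rho psi_vex (new x) + d_rho psi_cav (mixed x)) v2 = 0,
      ip (fun x => (energy n.+1 x - energy n x) / tau) xi
      + ipv (fun x => L12 L (z x) *m grad mr x - L22 L (z x) *m grad th x
                      + me x *: L23 L (z x)) (grad xi) = 0,
      ip (fun x => dlev tau eta n x / tau) w1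
      + ip (fun x => dot (L13 L (z x)) (grad mr x)
                     - dot (L23 L (z x)) (grad th x) + L33 L (z x) * me x) w1
      = 0 &
      ip me w2 - gamma_eta * ipv (grad (lev tau eta n.+1)) (grad w2)
      - ip (fun x => d_eta psi_vex (new x) + d_eta psi_cav (mixed x)) w2 = 0].

(* [nT] time steps; [rho0], [theta0], [eta0] are the given initial data. *)
Definition discrete_solution (nT : nat) (rho0 theta0 eta0 : 'rV[R]_d -> R) :
  Prop :=
  [/\ [/\ Pi1c tau nT (Vh l T) rho, Pi1c tau nT (Vh_pos a l T) theta &
          Pi1c tau nT (Vh l T) eta],
      Pi0 tau nT (Vh l T) mu_rho /\ Pi0 tau nT (Vh l T) mu_eta,
      [/\ Vh l T rho0, Vh_pos a l T theta0 & Vh l T eta0],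
      [/\ lev tau rho 0 = rho0, lev tau theta 0 = theta0 &
          lev tau eta 0 = eta0] &
      forall n, (n < nT)%N -> scheme_step n].

(* Physical dissipation of the step from t^n to t^(n+1). *)
Definition dissipation (n : nat) : R :=
  integral_on (cube a l) (fun x =>
    let g : 'cV[R]_(d + d + 1) :=
      col_mx (col_mx (grad (lev tau mu_rho n.+1) x)
                     (grad (lev tau theta n.+1) x))
             (lev tau mu_eta n.+1 x)%:M in
    dot g (mob_matrix L (mob_arg_at n x) *m g)).

Definition theta_defect (n : nat) (xi1 : 'rV[R]_d -> R) (x : 'rV[R]_d) : R :=
  d_theta (d_theta psi) (lev tau rho n x, xi1 x, lev tau eta n x)
  * dlev tau theta n x * dlev tau theta n x.

Definition hessian_defect (n : nat) (chi1 chi2 chi3 chi4 : 'rV[R]_d -> R)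
  (x : 'rV[R]_d) : R :=
  let u : 'cV[R]_2 :=
    \col_i (if i == 0 then dlev tau rho n x else dlev tau eta n x) in
  let th := lev tau theta n.+1 x in
  dot ((hessian psi_cav (chi1 x, th, chi2 x)
        - hessian psi_vex (chi3 x, th, chi4 x)) *m u) u.

Definition num_dissipation (n : nat)
  (xi1 chi1 chi2 chi3 chi4 : 'rV[R]_d -> R) : R :=
  gamma_rho / 2 * ipv a l (grad (dlev tau rho n)) (grad (dlev tau rho n))
  + gamma_eta / 2 * ipv a l (grad (dlev tau eta n)) (grad (dlev tau eta n))
  - 1 / 2 * integral_on (cube a l) (theta_defect n xi1)
  - 1 / 2 * integral_on (cube a l) (hessian_defect n chi1 chi2 chi3 chi4).

(* The integrability clauses say that the two inner products involving the
   intermediate functions are meaningful. *)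
Definition intermediate (n : nat)
  (xi1 chi1 chi2 chi3 chi4 : 'rV[R]_d -> R) : Prop :=
  [/\ forall x, cube a l x ->
        between (lev tau theta n x) (lev tau theta n.+1 x) (xi1 x),
      forall x, cube a l x ->
        between (lev tau rho n x) (lev tau rho n.+1 x) (chi1 x) /\
        between (lev tau rho n x) (lev tau rho n.+1 x) (chi3 x),
      forall x, cube a l x ->
        between (lev tau eta n x) (lev tau eta n.+1 x) (chi2 x) /\
        between (lev tau eta n x) (lev tau eta n.+1 x) (chi4 x),
      integrable_on (cube a l) (theta_defect n xi1) &
      integrable_on (cube a l) (hessian_defect n chi1 chi2 chi3 chi4)].

End Scheme.

(* Main.v *)
Require Import Defs.
From mathcomp Require Import all_boot all_order all_algebra.
From mathcomp Require Import all_classical all_reals all_analysis.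
From mathcomp Require Import interval_inference measurable_realfun ring lra.

Import Order.TTheory GRing.Theory Num.Theory.
Import numFieldNormedType.Exports.

Local Open Scope classical_set_scope.
Local Open Scope ring_scope.

(* Conservation of mass and of energy is the scheme tested with the constant 1.
   For the entropy, test the balance laws with mu_rho, theta, mu_eta and the
   equations for the chemical potentials with the increments of rho and eta:
   the L-terms add up to the physical dissipation, and what remains are the
   Taylor remainders of psi in theta about the old level, of psi_cav in
   (rho, eta) about the old level and of psi_vex in (rho, eta) about the new
   level.

   The second derivatives at the intermediate points equal these remainders,
   whichever points are chosen: the defects are therefore continuous functions
   of x, hence integrable, and their signs are the tangent inequalities for
   concave and convex functions.

   Gradients of finite element functions are constant in the open simplices,
   whose complement in the cube lies in finitely many hyperplanes and is
   Lebesgue-null. On that null set the gradients may be junk values of unknown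
   measurability; it is discarded by a property of the integral that holds for
   arbitrary functions. *)

(** * Directional derivatives *)

Section DirectionalDerivatives.
Context {R : realType} {V : normedModType R}.
Implicit Types (f g : V -> R) (u v z : V).

(** This turns existence and value of a directional derivative into a single limit, so that both
    pass through limit arguments together. *)
Lemma is_deriveP f z v (df : R) :
  is_derive z v f df <->
  h^-1 * (f (h *: v + z) - f z) @[h --> 0^'] --> df.
Proof.
split=> [[/cvg_ex[l fl] <-]|fl].
  have -> : 'D_v f z = l by exact: (cvg_lim _ fl).
  exact: fl.
split; first by apply/cvg_ex; exists df.
exact: (cvg_lim _ fl).
Qed.

(** For [k] nonzero, the quotient in direction [k *: v] with step [h] is [k] times the quotient in
    direction [v] with step [h * k], and [h * k] tends to 0 through nonzero values. *)
Lemma is_derive_scale f z v (k df : R) :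
  is_derive z v f df -> is_derive z (k *: v) f (k * df).
Proof.
have [->|k0] := eqVneq k 0; first by rewrite scale0r mul0r => _; exact: is_derive0.
move=> /is_deriveP fl; apply/is_deriveP.
have -> : (fun h => h^-1 * (f (h *: (k *: v) + z) - f z)) =
   (fun h => k * ((h * k)^-1 * (f ((h * k) *: v + z) - f z))).
  apply/funext => h; rewrite scalerA invfM.
  by rewrite [RHS]mulrA [k * _]mulrCA mulfV// mulr1.
apply: cvgMl_tmp => //.
apply: (cvg_comp _ _ _ fl).
have : (h * k @[h --> (0 : R)] --> (0 : R)).
  have := @cvgM _ _ _ _ id (cst k) 0 k cvg_id (cvg_cst k).
  by rewrite mul0r; apply.
move=> hk A /= /hk; rewrite /= !near_simpl !near_withinE.
apply: filter_app; near=> h => Ah h0; apply: Ah.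
by rewrite mulf_eq0 negb_or h0.
Unshelve. all: by end_near. Qed.

(** Restriction to a line makes Rolle's theorem and the mean value theorem available in a normed
    space. *)
Lemma is_derive_line f z v (t df : R) :
  is_derive (t *: v + z) v f df ->
  is_derive t 1 (fun s : R => f (s *: v + z)) df.
Proof.
move=> /is_deriveP fl.
suff : h^-1 * (f ((h *: 1 + t) *: v + z) - f (t *: v + z)) @[h --> 0^'] --> df.
  by move=> H; split; [apply/cvg_ex; exists df; exact: H|exact: (cvg_lim _ H)].
suff -> : (fun h => h^-1 * (f ((h *: 1 + t) *: v + z) - f (t *: v + z))) =
  (fun h => h^-1 * (f (h *: v + (t *: v + z)) - f (t *: v + z))) by [].
by apply/funext => h; rewrite [h *: _]mulr1 scalerDl addrA.
Qed.

(* The increment in direction [w] is taken at the moving point [h *: u + z], where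
   the mean value theorem and the continuity of ['D_w f] at [z] control it. *)
Lemma is_derive_add_direction f z u w (du : R) :
  is_derive z u f du -> (\forall y \near z, derivable f y w) ->
  {for z, continuous ('D_w f)} -> is_derive z (u + w) f (du + 'D_w f z).
Proof.
move=> /is_deriveP fu dw cw; apply/is_deriveP.
have -> : (fun h => h^-1 * (f (h *: (u + w) + z) - f z)) =
  (fun h => h^-1 * (f (h *: u + z) - f z) +
    h^-1 * (f (h *: w + (h *: u + z)) - f (h *: u + z))).
  apply/funext => h; rewrite -mulrDr; congr (_ * _).
  by rewrite [RHS]addrC addrA addrNK scalerDr addrA [h *: w + _]addrC.
apply: cvgD => //.
apply/cvgrPdist_lt => e e0.
have : \forall y \near z, derivable f y w /\ `|'D_w f z - 'D_w f y| < e.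
  near=> y; split; first by near: y.
  by near: y; move/cvgrPdist_lt : cw; apply.
move=> /nbhs_ballP[r /= r0 Hr].
(* For these [h], the displacement [s *: (h *: w) + h *: u] is shorter than [r]; the summand 1 keeps
   the denominator positive when both directions vanish. *)
have nw0 : 0 < `|w| + `|u| + 1 by rewrite ltr_pwDr// addr_ge0.
have hn : \forall h \near (0 : R), `|h| < r / (`|w| + `|u| + 1).
  by apply: (@nbhs0_lt _ R); rewrite divr_gt0.
rewrite near_withinE; apply: filterS hn => h hr1 h0.
have hr : `|h| * (`|w| + `|u|) < r.
  apply: (@le_lt_trans _ _ (`|h| * (`|w| + `|u| + 1))).
    by rewrite ler_wpM2l// lerDl.
  by rewrite -ltr_pdivlMr.
have Hs (s : R) : 0 <= s <= 1 -> ball z r (s *: (h *: w) + (h *: u + z)).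
  move=> /andP[s0 s1]; rewrite -ball_normE /=.
  rewrite addrA opprD addrCA subrr addr0 normrN; apply: le_lt_trans hr.
  apply: (le_trans (ler_normD _ _)); rewrite !normrZ mulrDr lerD//.
  by rewrite ger0_norm// ler_piMl// mulr_ge0.
(* Taking [s] in the unit interval with direction [h *: w] treats both signs of [h] at once. *)
have Dg (s : R) : 0 <= s <= 1 ->
    is_derive s 1 (fun s : R => f (s *: (h *: w) + (h *: u + z)))
      (h * 'D_w f (s *: (h *: w) + (h *: u + z))).
  move=> /Hs /Hr[/= dy _]; apply: is_derive_line.
  by apply: is_derive_scale; exact: derivableP.
have [] := @MVT_segment R (fun s : R => f (s *: (h *: w) + (h *: u + z)))
   (fun s => h * 'D_w f (s *: (h *: w) + (h *: u + z))) 0 1 ler01.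
- by move=> s /[!in_itv]/= /andP[s0 s1]; apply: Dg; rewrite !ltW.
- apply: derivable_within_continuous => s; rewrite in_itv/= => /Dg.
  by case.
move=> c; rewrite in_itv/= => c01.
rewrite scale1r scale0r add0r subr0 mulr1 => ->.
rewrite mulrA mulVf// mul1r.
by have /Hr[] := Hs _ c01.
Unshelve. all: by end_near. Qed.

(** Smoothness of potentials is stated in the coordinate directions; this provides the derivatives
    in oblique directions. Scaling reduces it to the sum of two directions. *)
Lemma is_derive_comb f z u w (a b : R) :
  derivable f z u -> (\forall y \near z, derivable f y w) ->
  {for z, continuous ('D_w f)} ->
  is_derive z (a *: u + b *: w) f (a * 'D_u f z + b * 'D_w f z).
Proof.
move=> du dw cw.
have dbw : \forall y \near z, is_derive y (b *: w) f (b * 'D_w f y).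
  by apply: filterS dw => y dy; apply: is_derive_scale; exact: derivableP.
have e : \forall y \near z, 'D_(b *: w) f y = b * 'D_w f y.
  by apply: filterS dbw => y [].
rewrite -(nbhs_singleton e); apply: is_derive_add_direction.
- by apply: is_derive_scale; exact: derivableP.
- by apply: filterS dbw => y [].
- have H : {for z, continuous (fun y => b * 'D_w f y)}.
    by apply: cvgM => //; exact: cvg_cst.
  rewrite /prop_for /continuous_at (nbhs_singleton e).
  apply: cvg_trans H; apply: near_eq_cvg; apply: filterS e => y ->//.
Qed.

(** The chord inequality bounds every difference quotient with step in [(0, 1)] by the full
    increment, and the bound survives the limit from the right. *)
Lemma derive_le_convex f z v (df : R) :
  is_derive z v f df ->
  (forall t, 0 < t < 1 -> f (t *: v + z) <= (1 - t) * f z + t * f (v + z)) ->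
  df <= f (v + z) - f z.
Proof.
move=> /is_deriveP fl cf.
have fr : h^-1 * (f (h *: v + z) - f z) @[h --> (0:R)^'+] --> df.
  by apply: cvg_trans fl; apply: cvg_app; apply: within_subset => y /=;
    rewrite lt0r => /andP[].
rewrite -(cvg_lim _ fr)//; apply: limr_le; first by apply/cvg_ex; exists df.
near=> h.
have h0 : 0 < h by near: h; exact: nbhs_right_gt.
have h1 : h < 1 by near: h; exact: nbhs_right_lt.
rewrite mulrC ler_pdivrMr// lerBlDr; apply: le_trans (cf h _) _; first by rewrite h0.
lra.
Unshelve. all: by end_near. Qed.

(** Lagrange's form of the remainder, from Rolle's theorem for [phi], whose derivative at [t] is
    [(1 - t) * (G2 t - 2 * K)]. *)
Lemma taylor2_line f g1 g2 z v :
  (forall t : R, 0 <= t <= 1 -> is_derive (t *: v + z) v f (g1 (t *: v + z))) ->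
  (forall t : R, 0 <= t <= 1 -> is_derive (t *: v + z) v g1 (g2 (t *: v + z))) ->
  exists2 c : R, 0 < c < 1 & f (v + z) = f z + g1 z + g2 (c *: v + z) / 2.
Proof.
move=> Df Dg.
pose F t := f (t *: v + z); pose G1 t := g1 (t *: v + z).
pose G2 t := g2 (t *: v + z).
have DF (t : R) : 0 <= t <= 1 -> is_derive t 1 F (G1 t)
  by move=> t01; exact: is_derive_line (Df t t01).
have DG (t : R) : 0 <= t <= 1 -> is_derive t 1 G1 (G2 t)
  by move=> t01; exact: is_derive_line (Dg t t01).
(* [K] is the remainder itself; it is the coefficient for which [phi] takes the value [F 1] at both
   endpoints. *)
pose K := F 1 - F 0 - G1 0.
pose phi := F + (fun t => G1 t * (1 - t)) + (fun t => K * (1 - t) ^+ 2).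
have Dphi (t : R) : 0 <= t <= 1 -> is_derive t 1 phi (G2 t * (1 - t) - K * 2 * (1 - t)).
  move=> t01.
  have := DF _ t01; have := DG _ t01 => DG1 DF1.
  have D1 : is_derive t 1 (cst (1 : R) - id) (- 1).
    by apply: is_derive_eq; rewrite sub0r.
  have -> : phi = F + (G1 * (cst (1 : R) - id)) + K \*: ((cst (1 : R) - id) ^+ 2).
    by apply/funext => x; rewrite /phi !fctE.
  apply: is_derive_eq.
  rewrite !fctE /GRing.scale /=; ring.
have [] := @Rolle R phi 0 1 ltr01.
- by move=> x; rewrite in_itv/= => /andP[x0 x1]; have [] := Dphi x; rewrite ?ltW.
- apply: derivable_within_continuous => x; rewrite in_itv/= => x01.
  by have [] := Dphi x x01.
- by rewrite /phi !fctE /K subrr subr0 !expr2 !mulr0 !mulr1 !addr0; ring.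
move=> c /[!in_itv]/= c01 [_ dc].
exists c => //.
have [_] : is_derive c 1 phi (G2 c * (1 - c) - K * 2 * (1 - c)).
  by apply: Dphi; case/andP: c01 => c0 c1; rewrite !ltW.
rewrite dc => /esym/eqP.
(* Since [c < 1], the factor [1 - c] is nonzero, hence [G2 c = K * 2]. *)
rewrite -mulrBl mulf_eq0 subr_eq0 [1 - c == 0]subr_eq0 => /orP[/eqP|/eqP]; last first.
  by case/andP: c01 => _ /[swap] <-; rewrite ltxx.
rewrite /G2 => ->; rewrite /K /F /G1 scale0r scale1r add0r mulfK//; ring.
Qed.

End DirectionalDerivatives.

(** * Lebesgue measure on row vectors *)

Section NullSets.
Context d (T : measurableType d) (R : realType).
Variable mu : {measure set T -> \bar R}.
Import HBNNSimple.
Local Open Scope ereal_scope.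

(* [f] need not be measurable: the integral is a supremum over simple functions,
   and a simple function may be set to 0 on [N] without changing its integral. *)
Lemma integral_setD_null (D N : set T) (f : T -> \bar R) :
  measurable N -> mu N = 0 ->
  \int[mu]_(x in D) f x = \int[mu]_(x in D `\` N) f x.
Proof.
move=> mN muN.
suff ge0 g : (forall x, 0 <= g x) ->
    \int[mu]_(x in D) g x = \int[mu]_(x in D `\` N) g x.
  by rewrite integralE [RHS]integralE !ge0.
move=> g0; apply/eqP; rewrite eq_le !ge0_integralE//; apply/andP; split.
- apply: ge_ereal_sup => _ [h /= hg <-].
  have mCN := measurableC mN.
  apply: le_ereal_sup_tmp.
  exists (sintegral mu (proj_nnsfun h mCN)).
    exists (proj_nnsfun h mCN) => //= x; rewrite mindicE.
    have := hg x; rewrite !patchE in_setD in_setC.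
    case: (x \in N); case: (x \in D); rewrite ?mulr1 ?mulr0 ?lee_fin//=.
  rewrite -!integralT_nnsfun le_eqVlt; apply/orP; left; apply/eqP.
  apply: ge0_ae_eq_integral => //=.
  + by apply/measurable_EFinP; exact: measurable_funPT.
  + by apply/measurable_EFinP; exact: (measurable_funPT (proj_nnsfun h mCN)).
  + by move=> x _; rewrite lee_fin.
  + by move=> x _; rewrite lee_fin (@fun_ge0 _ _ (proj_nnsfun h mCN)).
  + exists N; split => // x /= H; apply: contrapT => nN; apply: H => _.
    by rewrite mindicE mem_set// mulr1.
(* Here the simple function is kept as it is: extending [g] by 0 from the smaller domain gives a
   smaller function. *)
- apply: ge_ereal_sup => _ [h /= hg <-].
  apply: ereal_sup_ubound; exists h => //= x.
  apply: le_trans (hg x) _; rewrite !patchE in_setD.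
  by case: (x \in D); case: (x \in N).
Qed.

End NullSets.

Section LebesgueSpace.
Context {R : realType}.
Local Notation X n := (ms_type (@lebesgueSpace R n)).
Local Notation mu n := (ms_measure (@lebesgueSpace R n)).

Lemma measurable_coord n i : measurable_fun setT (fun x : X n => Defs.coord x i).
Proof.
elim: n i => [|n IH] i /=; first exact: measurable_cst.
case: i => [|i]; first exact: measurable_fst.
by apply: (measurableT_comp (IH i)); exact: measurable_snd.
Qed.

(** An open set is the union of the rational boxes that it contains. There are countably many of
    them, and each pulls back to finitely many conditions on measurable coordinates. *)
Lemma measurable_to_rV_open n (O : set 'rV[R]_n) :
  open O -> measurable (@to_rV R n @^-1` O).
Proof.
move=> oO.
pose box (p : 'rV[rat]_n * 'rV[rat]_n) : set 'rV[R]_n :=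
  [set x | forall i, ratr (p.1 0 i) < x 0 i < ratr (p.2 0 i)].
have -> : O = \bigcup_p (if pselect (box p `<=` O) then box p else set0).
  apply/seteqP; split=> x; last by case=> p _ /=; case: pselect => // /[apply].
  move=> Ox; have : nbhs x O by exact: open_nbhs_nbhs.
  move=> /nbhs_ballP[e /= e0 eO].
  (* Balls of row vectors are entrywise, so a box with endpoints within [e] of the coordinates of
     [x] lies in the ball. *)
  have rat1 i : {q : rat | x 0 i - e < ratr q < x 0 i}.
    have : x 0 i - e < x 0 i by rewrite gtrBl.
    by move=> /rat_in_itvoo /cid[q /[!in_itv]/= qi]; exists q.
  have rat2 i : {q : rat | x 0 i < ratr q < x 0 i + e}.
    have : x 0 i < x 0 i + e by rewrite ltrDl.
    by move=> /rat_in_itvoo /cid[q /[!in_itv]/= qi]; exists q.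
  pose p := (\row_i sval (rat1 i), \row_i sval (rat2 i)).
  exists p => //=; case: pselect => [_ i|[]].
    rewrite !mxE; case: (rat1 i) => q /= /andP[_ ->].
    by case: (rat2 i) => r /= /andP[-> _].
  move=> y yp; apply: eO; split => // i j; rewrite ord1.
  have := yp j; rewrite /= !mxE; case: (rat1 j) => q /= /andP[h1 h2].
  case: (rat2 j) => r /= /andP[h3 h4] /andP[h5 h6].
  by rewrite /ball/= ltr_distl; apply/andP; split; lra.
rewrite preimage_bigcup; apply: countable_bigcupT_measurable => // p.
case: pselect => [? /=|? /=]; last by rewrite preimage_set0.
rewrite /box.
have -> : @to_rV R n @^-1` [set x | forall i, ratr (p.1 0 i) < x 0 i < ratr (p.2 0 i)]
  = \bigcap_(i in [set: 'I_n]) (fun x => Defs.coord x i) @^-1` `](ratr (p.1 0 i)), (ratr (p.2 0 i))[%classic.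
  apply/seteqP; split=> x /= H i; first by move=> _; rewrite /= in_itv/=; have := H i; rewrite mxE.
  by have := H i I; rewrite /= in_itv/= mxE.
apply: fin_bigcap_measurable => // i _.
by rewrite -[Y in measurable Y]setTI; apply: measurable_coord.
Qed.

Lemma measurable_continuous_to_rV n (f : 'rV[R]_n -> R) :
  continuous f -> measurable_fun setT (f \o @to_rV R n).
Proof.
move=> /continuousP cf; apply: (measurability _ (RGenOpens.measurableE R)).
move=> _ [_ [a [b ->] <-]]; rewrite setTI comp_preimage.
by apply: measurable_to_rV_open; apply: cf; exact: interval_open.
Qed.

Lemma measurable_to_rV_closed n (F : set 'rV[R]_n) :
  closed F -> measurable (@to_rV R n @^-1` F).
Proof.
move=> /closed_openC /measurable_to_rV_open /measurableC.
by rewrite preimage_setC setCK.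
Qed.

(** The corner is indexed by [nat] so that the induction can shift it: the box is an interval times
    the lower-dimensional box with corner [a i.+1]. *)
Lemma lebesgueSpace_box_lty n (a : nat -> R) (l : R) :
  (mu n [set x : X n | forall i, (i < n)%N -> (a i <= Defs.coord x i <= a i + l)%R]
    < +oo)%E.
Proof.
elim: n a => [|n IH] a /=.
  by rewrite diracE; case: (_ \in _); rewrite ltry.
pose A2 := [set x : X n | forall i, (i < n)%N -> a i.+1 <= Defs.coord x i <= a i.+1 + l].
have -> : [set x : (measurableTypeR R * X n)%type | forall i, (i < n.+1)%N ->
    a i <= Defs.coord (n := n.+1) x i <= a i + l] = `[a 0%N, a 0%N + l]%classic `*` A2.
  apply/seteqP; split=> [x H|x [H1 H2] [|i]].
  - by split; [have := H 0%N isT; rewrite /= in_itv|move=> i /= lin; exact: (H i.+1)].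
  - by move: H1; rewrite /= in_itv.
  - exact: H2.
have mA2 : measurable A2.
  have -> : A2 = \bigcap_(i in [set: 'I_n]) (fun x => Defs.coord x i) @^-1` `[a i.+1, a i.+1 + l]%classic.
    apply/seteqP; split=> [x H i _|x H i lin].
      by rewrite /= in_itv/=; exact: H.
    by have := H (Ordinal lin) I; rewrite /= in_itv.
  apply: fin_bigcap_measurable => // i _.
  by rewrite -[Y in measurable Y]setTI; apply: measurable_coord.
rewrite /sf_product product_measure1E//.
rewrite lte_mul_pinfty//; last exact: IH.
suff : @lebesgue_measure R [set` `[a 0%N, a 0%N + l]] \is a fin_num by [].
by rewrite lebesgue_measure_itv/=; case: ifPn.
Qed.

(** Induction on the dimension. If a coefficient after the first is nonzero, every slice at fixed
    first coordinate is a null hyperplane; otherwise the first coordinate is fixed and the set is a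
    point times the whole remaining space. *)
Lemma lebesgueSpace_hyperplane0 n (g : nat -> R) (c : R) :
  (exists2 i, (i < n)%N & g i != 0) ->
  mu n [set x : X n | \sum_(i < n) g i * Defs.coord x i + c = 0] = 0%E.
Proof.
elim: n g c => [g c [//]|n IH g c [i lin gi]] /=.
have -> : [set x : (measurableTypeR R * X n)%type |
    \sum_(i < n.+1) g i * Defs.coord (n := n.+1) x i + c = 0]
  = [set x | \sum_(i < n) g i.+1 * Defs.coord x.2 i + (g 0%N * x.1 + c) = 0].
  by apply/seteqP; split=> x /=; rewrite big_ord_recl/= => H; rewrite -[RHS]H; ring.
have [[j ljn gj]|nex] := pselect (exists2 i, (i < n)%N & g i.+1 != 0).
  rewrite /sf_product /product_measure1; apply: integral0_eq => x _ /=.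
  rewrite -(IH (fun i => g i.+1) (g 0%N * x + c)); last by exists j.
  by congr (mu n _); apply/seteqP; split=> y /=; rewrite /xsection/= inE.
have g0 : g 0%N != 0.
  by case: i lin gi => [//|i] lin gi; exfalso; apply: nex; exists i.
have -> : [set x : (measurableTypeR R * X n)%type |
    \sum_(i < n) g i.+1 * Defs.coord x.2 i + (g 0%N * x.1 + c) = 0]
  = [set - c / g 0%N] `*` setT.
  have E (x : (measurableTypeR R * X n)%type) : \sum_(i < n) g i.+1 * Defs.coord x.2 i = 0.
    apply: big1 => j _; suff -> : g j.+1 = 0 by rewrite mul0r.
    by apply/eqP; apply: contra_notT nex => gj; exists j.
  apply/seteqP; split=> x /=; rewrite E add0r.
    by move=> /eqP; rewrite addr_eq0 => /eqP H; split => //; rewrite -H; field.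
  by move=> [-> _]; field.
rewrite /sf_product product_measure1E//.
(* The second factor may be infinite; the product is still 0 in the extended reals. *)
suff : (@lebesgue_measure R [set (- c / g 0%N)%R] * mu n [set: X n] = 0)%E by [].
by rewrite lebesgue_measure_set1 mul0e.
Qed.

End LebesgueSpace.

(** * Affine functions and simplices *)

Lemma negligible_countable_bigcup d (T : measurableType d) (R : realType)
  (mu : {measure set T -> \bar R}) (I : countType) (F : I -> set T) :
  (forall i, mu.-negligible (F i)) -> mu.-negligible (\bigcup_i F i).
Proof.
move=> nF; pose G k := if unpickle k is Some i then F i else set0.
have -> : \bigcup_i F i = \bigcup_k G k.
  apply/seteqP; split=> [x [i _ Fx]|x [k _]]; last first.
    by rewrite /G; case: unpickle => // i; exists i.
  by exists (pickle i) => //; rewrite /G pickleK.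
apply: negligible_bigcup => k; rewrite /G; case: unpickle => //.
exact: negligible_set0.
Qed.

Section RealContinuous.
Context {R : realType} {T : topologicalType}.
Implicit Types f g : T -> R.

Lemma continuous_fun_cst (c : R) : continuous (fun _ : T => c).
Proof. by move=> x; exact: cvg_cst. Qed.

Lemma continuous_funD f g : continuous f -> continuous g ->
  continuous (fun x => f x + g x).
Proof. by move=> cf cg x; exact: (cvgD (cf x) (cg x)). Qed.

Lemma continuous_funM f g : continuous f -> continuous g ->
  continuous (fun x => f x * g x).
Proof. by move=> cf cg x; exact: (cvgM (cf x) (cg x)). Qed.

Lemma continuous_fun_sum (I : Type) (r : seq I) (F : I -> T -> R) :
  (forall i, continuous (F i)) -> continuous (fun x => \sum_(i <- r) F i x).
Proof.
move=> cF x; apply: cvg_big => [|i _]; last exact: cF.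
exact: (@pseudometric_normed_Zmodule.add_continuous R R).
Qed.

End RealContinuous.

(** The measure estimates index coordinates by [nat]; a family over ['I_n] is handed to them as
    [nth 0] of its list of values. *)
Lemma nth_map_enum_ord (R : pzRingType) n (f : 'I_n -> R) (i : 'I_n) :
  nth 0 [seq f j | j <- enum 'I_n] i = f i.
Proof. by rewrite (nth_map i) ?size_enum_ord// nth_ord_enum. Qed.

Section Affine.
Context {R : realType} {d : nat}.

Lemma continuous_affine (g : 'cV[R]_d) (c : R) :
  continuous (fun x : 'rV[R]_d => (x *m g) 0 0 + c).
Proof.
apply: continuous_funD; last exact: continuous_fun_cst.
have -> : (fun x : 'rV[R]_d => (x *m g) 0 0) =
    (fun x : 'rV[R]_d => \sum_j x 0 j * g j 0).
  by apply/funext => y; rewrite mxE.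
apply: continuous_fun_sum => j; apply: continuous_funM.
  exact: coord_continuous.
exact: continuous_fun_cst.
Qed.

(** Affine independence makes the matrix [M] with rows [(1, p i)] invertible. The barycentric
    coordinates of [x] are the entries of [(1, x)] times its inverse, hence affine in [x]. *)
Lemma barycentric (p : 'I_d.+1 -> 'rV[R]_d) : affinely_independent p ->
  exists (c : 'I_d.+1 -> R) (g : 'I_d.+1 -> 'cV[R]_d),
  let lam i x := (x *m g i) 0 0 + c i in
  (forall w : 'I_d.+1 -> R, \sum_i w i = 1 ->
    forall i, lam i (\sum_j w j *: p j) = w i) /\
  (forall x, \sum_i lam i x = 1 /\ \sum_i lam i x *: p i = x).
Proof.
move=> aip.
pose P : 'M[R]_(d.+1, d) := \matrix_(i, j) p i 0 j.
pose M : 'M[R]_(d.+1, 1 + d) := row_mx (const_mx 1) P.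
have wM (w : 'rV[R]_d.+1) : w *m M = row_mx (\sum_i w 0 i)%:M (\sum_i w 0 i *: p i).
  rewrite /M mul_mx_row; congr row_mx.
    apply/matrixP => i j; rewrite !ord1 !mxE eqxx mulr1n.
    by apply: eq_bigr => k _; rewrite !mxE mulr1.
  apply/rowP => j; rewrite !mxE summxE.
  by apply: eq_bigr => k _; rewrite !mxE.
have uM : (M : 'M[R]_(d.+1)) \in unitmx.
  rewrite -row_free_unit; apply/row_freeP.
  have : row_free (M : 'M[R]_(d.+1)).
    (* A row in the left kernel of [M] has coefficients of sum 0 whose combination of the points
       vanishes, so it is 0. *)
    rewrite -kermx_eq0; apply/eqP/row_matrixP => i; rewrite row0.
    have : row i (kermx (M : 'M[R]_(d.+1))) *m M = 0.
      by apply/sub_kermxP; rewrite row_sub.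
    set w := row i _; rewrite wM => /eqP.
    rewrite row_mx_eq0 => /andP[/eqP w1 /eqP w2].
    have {}w1 : \sum_i w 0 i = 0.
      by have := congr1 (fun A : 'M[R]_1 => A 0 0) w1; rewrite !mxE eqxx mulr1n.
    by apply/rowP => k; rewrite (aip (fun i => w 0 i) w1 w2) mxE.
  by move=> /row_freeP.
pose N : 'M[R]_(1 + d, d.+1) := invmx (M : 'M[R]_(d.+1)).
pose lamv (x : 'rV[R]_d) : 'rV[R]_d.+1 := row_mx 1%:M x *m N.
have lamvE x i : lamv x 0 i = (x *m col i (dsubmx N)) 0 0 + usubmx N 0 i.
  rewrite /lamv -[N in LHS]vsubmxK mul_row_col mul1mx mxE addrC; congr (_ + _).
  by rewrite !mxE; apply: eq_bigr => k _; rewrite !mxE.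
exists (fun i => usubmx N 0 i), (fun i => col i (dsubmx N)) => lam; split.
- move=> w w1 i; rewrite /lam -lamvE /lamv.
  have := wM (\row_j w j).
  have -> : \sum_k (\row_j w j) 0 k = 1.
    by rewrite -w1; apply: eq_bigr => k _; rewrite mxE.
  have -> : \sum_k (\row_j w j) 0 k *: p k = \sum_j w j *: p j.
    by apply: eq_bigr => k _; rewrite mxE.
  move=> <-.
  by rewrite -mulmxA (mulmxV uM) mulmx1 mxE.
- move=> x.
  have : lamv x *m M = row_mx 1%:M x by rewrite -mulmxA (mulVmx uM) mulmx1.
  rewrite wM => /eq_row_mx[H1 H2]; split.
    have := congr1 (fun A : 'M[R]_1 => A 0 0) H1; rewrite !mxE eqxx !mulr1n => <-.
    by apply: eq_bigr => i _; rewrite lamvE.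
  by rewrite -[RHS]H2; apply: eq_bigr => i _; rewrite lamvE.
Qed.

Local Notation mu := (ms_measure (@lebesgueSpace R d)).

Lemma negligible_hyperplane (g : 'cV[R]_d) (c : R) : g != 0 ->
  mu.-negligible (@to_rV R d @^-1` [set x | (x *m g) 0 0 + c = 0]).
Proof.
move=> g0; apply/negligibleP.
  apply: measurable_to_rV_closed.
  apply: (@preimage_closed _ _ _ [set 0]); last exact: closed_eq.
  by move=> x _; apply: continuous_affine.
have [i gi] : exists i, g i 0 != 0.
  apply: contrapT => H; move/eqP : g0; apply; apply/colP => i; rewrite mxE.
  by apply/eqP; apply: contra_notT H => gi; exists i.
pose g' (k : nat) := nth 0 [seq g j 0 | j <- enum 'I_d] k.
rewrite -(@lebesgueSpace_hyperplane0 _ d g' c); last first.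
  by exists (nat_of_ord i) => //; rewrite /g' nth_map_enum_ord.
have E x : (to_rV x *m g) 0 0 = \sum_(i < d) g' i * Defs.coord x i.
  rewrite mxE; apply: eq_bigr => j _.
  by rewrite /to_rV mxE /g' nth_map_enum_ord mulrC.
by congr (mu _); apply/seteqP; split=> x /=; rewrite E.
Qed.

(** [U] is the set where all barycentric coordinates are positive. A point of the simplex outside it
    has a vanishing coordinate, so it lies on one of [d + 1] hyperplanes. *)
Lemma simplex_boundary_negligible (p : 'I_d.+1 -> 'rV[R]_d) :
  (0 < d)%N -> affinely_independent p ->
  exists U : set 'rV[R]_d, [/\ open U, U `<=` hull p setT &
    mu.-negligible (@to_rV R d @^-1` (hull p setT `\` U))].
Proof.
move=> d0 aip; have [c [g [lamw lamx]]] := barycentric _ aip.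
pose lam i (x : 'rV[R]_d) := (x *m g i) 0 0 + c i.
exists [set x | forall i, 0 < lam i x]; split.
- rewrite openE => x xpos.
  suff : \forall y \near x, forall i, 0 < lam i y by [].
  apply: (@filter_forall _ _ (fun i y => 0 < lam i y) (nbhs x)) => i.
  have oi : open (lam i @^-1` [set y | 0 < y]).
    by apply: open_comp; [move=> y _; exact: continuous_affine|exact: open_gt].
  by apply: open_nbhs_nbhs; split => //; exact: xpos.
- move=> x xpos; have [l1 lx] := lamx x.
  by exists (lam^~ x); split => //= i; exact/ltW/xpos.
(* With zero linear part, [lam i] would be constantly 1 because of vertex [i], against its value 0
   at another vertex, which exists as [0 < d]. *)
have g0 i : g i != 0.
  apply/eqP => gi0.
  pose w (j : 'I_d.+1) k : R := (k == j)%:R.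
  have w1 j : \sum_k w j k = 1.
    by rewrite (bigD1 j)//= /w eqxx big1 ?addr0// => k /negbTE ->.
  have := lamw _ (w1 i) i; rewrite gi0 mulmx0 mxE add0r /w eqxx => ci1.
  have [j ji] : exists j : 'I_d.+1, j != i.
    case: (eqVneq i ord0) => [->|i0]; last by exists ord0; rewrite eq_sym.
    by exists ord_max; rewrite -(inj_eq val_inj)/= -lt0n.
  have := lamw _ (w1 j) i; rewrite gi0 mulmx0 mxE add0r ci1 /w eq_sym (negbTE ji).
  by move/eqP; rewrite oner_eq0.
apply: (@negligibleS _ _ _ _ (\bigcup_(i in [set: 'I_d.+1]) (@to_rV R d @^-1` [set x | lam i x = 0]))).
  move=> y [[w [w0 _ w1 yw]]] /= /existsNP[i ni]; exists i => //=.
  have lw : lam i (to_rV y) = w i by rewrite yw; exact: lamw.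
  apply/eqP; rewrite eq_le leNgt; apply/andP; split; first exact/negP.
  by rewrite lw.
apply: negligible_countable_bigcup => i; exact: negligible_hyperplane.
Qed.

Lemma grad_affine (U : set 'rV[R]_d) (v : 'rV[R]_d -> R) g c x :
  open U -> U x -> (forall y, U y -> v y = (y *m g) 0 0 + c) -> grad v x = g.
Proof.
move=> oU Ux vE; apply/colP => i; rewrite mxE.
have : is_derive x (delta_mx 0 i) v (g i 0).
  apply: (@near_eq_is_derive _ _ _ (fun y : 'rV[R]_d => (y *m g) 0 0 + c)).
    have : nbhs x U by exact: open_nbhs_nbhs.
    by apply: filterS => y /vE ->.
  apply/is_deriveP.
  apply: cvg_near_cst; rewrite near_withinE; near=> h => h0.
  rewrite mulmxDl mxE -scalemxAl mxE.
  have -> : ((delta_mx 0 i : 'rV[R]_d) *m g) 0 0 = g i 0 by rewrite -rowE mxE.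
  rewrite [X in _ * X](_ : _ = h * g i 0); last by ring.
  by rewrite mulrA mulVf// mul1r.
by case.
Unshelve. all: by end_near. Qed.

End Affine.

(** * Finite element functions on the open cells *)

Section Mesh.
Context {R : realType} {d : nat}.
Variables (a : 'rV[R]_d) (l : R) (T : @mesh R d).
Local Notation mu := (ms_measure (@lebesgueSpace R d)).

(** This interface is all that the integration arguments use of the triangulation: open sets inside
    the cells that fill the cube up to a null set. *)
Definition open_cells (U : cell T -> set 'rV[R]_d) : Prop :=
  [/\ forall K, open (U K), forall K, U K `<=` simplex K,
      forall K, U K `<=` cube a l &
      mu.-negligible (@to_rV R d @^-1` (cube a l `\` \bigcup_K U K))].

Lemma open_cells_exist : (0 < d)%N ->
  conforming_periodic_triangulation a l T -> exists U, open_cells U.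
Proof.
move=> d0 [ai cov _ _].
have /choice[U UP] : forall K : cell T, exists U : set 'rV[R]_d,
    [/\ open U, U `<=` simplex K &
    mu.-negligible (@to_rV R d @^-1` (simplex K `\` U))].
  by move=> K; apply: simplex_boundary_negligible.
have sU K : U K `<=` simplex K by have [] := UP K.
exists U; split=> //.
- by move=> K; have [] := UP K.
- by move=> K x /sU Kx; rewrite -cov; exists K.
- apply: (@negligibleS _ _ _ _
    (\bigcup_K (@to_rV R d @^-1` (simplex K `\` U K)))).
    move=> x /= []; rewrite -cov => -[K _ Kx] nx; exists K => //=; split => //.
    by move=> Ux; apply: nx; exists K.
  by apply: negligible_countable_bigcup => K; have [] := UP K.
Qed.

Lemma cube_compact : compact (cube a l).
Proof.
have -> : cube a l = [set x : 'rV[R]_d | forall i, `[a 0 i, a 0 i + l]%classic (x ord0 i)].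
  by apply/seteqP; split=> x H i; have := H i; rewrite /= in_itv.
exact: (@rV_compact R d (fun i => `[a 0 i, a 0 i + l]%classic)
  (fun i => @segment_compact R (a 0 i) (a 0 i + l))).
Qed.

Lemma measurable_cube : measurable (@to_rV R d @^-1` cube a l).
Proof.
exact: (@measurable_to_rV_closed R d _
  (compact_closed (@norm_hausdorff R 'rV[R]_d) cube_compact)).
Qed.

Lemma cube_lty : (mu (@to_rV R d @^-1` cube a l) < +oo)%E.
Proof.
have := @lebesgueSpace_box_lty R d (fun k => nth 0 [seq a 0 j | j <- enum 'I_d] k) l.
congr (mu _ < _)%E; apply/seteqP; split=> x /= H.
  move=> i; have := H i (ltn_ord i).
  by rewrite nth_map_enum_ord /to_rV mxE.
move=> i lin; have := H (Ordinal lin).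
by rewrite -(@nth_map_enum_ord _ _ (fun j => a 0 j)) /to_rV mxE.
Qed.

Lemma continuous_bounded_cube (f : 'rV[R]_d -> R) : continuous f ->
  exists M, forall x, cube a l x -> `|f x| <= M.
Proof.
move=> cf.
have : bounded_set (f @` cube a l).
  apply: compact_bounded; apply: continuous_compact; last exact: cube_compact.
  exact: continuous_subspaceT.
move=> [M [_ HM]]; exists (`|M| + 1) => x cx.
by apply: HM; [rewrite ltr_pwDr// ler_norm|exists x].
Qed.

Lemma integrable_continuous_cube (f : 'rV[R]_d -> R) : continuous f ->
  integrable_on (cube a l) f.
Proof.
move=> cf; apply: (@measurable_bounded_integrable _ _ _ _ (f \o @to_rV R d)).
- exact: measurable_cube.
- exact: cube_lty.
- by apply: (@measurable_funS _ _ _ _ setT) => //; exact: measurable_continuous_to_rV.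
- have [M HM] := continuous_bounded_cube f cf.
  exists M; split; first exact: num_real.
  by move=> y My x /= cx; apply: le_trans (ltW My); exact: HM.
Qed.

Section Cells.
Variables (U : cell T -> set 'rV[R]_d) (hU : open_cells U).

(** The representative [F] is continuous on the whole space, hence bounded on the compact cube.
    Values of [f] off the open cells are free, which admits gradients of finite element
    functions. *)
Definition piecewise_continuous (f : 'rV[R]_d -> R) : Prop :=
  forall K, exists2 F : 'rV[R]_d -> R, continuous F &
    forall x, U K x -> f x = F x.

Lemma pwc_continuous f : continuous f -> piecewise_continuous f.
Proof. by move=> cf K; exists f. Qed.

Lemma pwc_cst (c : R) : piecewise_continuous (fun _ => c).
Proof. by apply: pwc_continuous; exact: continuous_fun_cst. Qed.

Lemma pwcD f g : piecewise_continuous f -> piecewise_continuous g ->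
  piecewise_continuous (fun x => f x + g x).
Proof.
move=> pf pg K; have [F cF fE] := pf K; have [G cG gE] := pg K.
exists (fun x => F x + G x); first exact: continuous_funD.
by move=> x Ux; rewrite fE// gE.
Qed.

Lemma pwcM f g : piecewise_continuous f -> piecewise_continuous g ->
  piecewise_continuous (fun x => f x * g x).
Proof.
move=> pf pg K; have [F cF fE] := pf K; have [G cG gE] := pg K.
exists (fun x => F x * G x); first exact: continuous_funM.
by move=> x Ux; rewrite fE// gE.
Qed.

Lemma pwcZ (c : R) f : piecewise_continuous f ->
  piecewise_continuous (fun x => c * f x).
Proof. by move=> pf; apply: pwcM => //; exact: pwc_cst. Qed.

Lemma pwcN f : piecewise_continuous f -> piecewise_continuous (fun x => - f x).
Proof.
move=> /(pwcZ (-1)); congr piecewise_continuous.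
by apply/funext => x; rewrite mulN1r.
Qed.

Lemma pwcB f g : piecewise_continuous f -> piecewise_continuous g ->
  piecewise_continuous (fun x => f x - g x).
Proof. by move=> pf pg; apply: pwcD => //; exact: pwcN. Qed.

Lemma pwc_sum (I : Type) (r : seq I) (F : I -> 'rV[R]_d -> R) :
  (forall i, piecewise_continuous (F i)) ->
  piecewise_continuous (fun x => \sum_(i <- r) F i x).
Proof.
move=> pF; elim: r => [|i r IH].
  by under eq_fun do rewrite big_nil; exact: pwc_cst.
by under eq_fun do rewrite big_cons; exact: pwcD.
Qed.

(* The first clause holds for every [f], measurable or not. *)
Lemma conull_domain : exists E : set (ms_type (@lebesgueSpace R d)),
  [/\ measurable E, E `<=` @to_rV R d @^-1` (\bigcup_K U K),
    E `<=` @to_rV R d @^-1` cube a l &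
   (forall f, integral_on (cube a l) f = \int[mu]_(x in E) f (to_rV x)) /\
   (forall f, piecewise_continuous f -> mu.-integrable E (fun x => (f (to_rV x))%:E))].
Proof.
have [oU _ cU [N [mN N0 sN]]] := hU.
have mC := measurable_cube.
(* [N] is a measurable null set that covers the part of the cube outside the open cells. *)
exists (@to_rV R d @^-1` cube a l `\` N).
have mE : measurable (@to_rV R d @^-1` cube a l `\` N) by exact: measurableD.
have EU : @to_rV R d @^-1` cube a l `\` N `<=` @to_rV R d @^-1` (\bigcup_K U K).
  by move=> x [cx nx]; apply: contrapT => nUx; apply: nx; apply: sN.
split=> //; split.
  by move=> f; rewrite /integral_on /Rintegral; congr fine; exact: integral_setD_null.
move=> f pf; apply: (@measurable_bounded_integrable _ _ _ _ (f \o @to_rV R d)) => //.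
- apply: le_lt_trans cube_lty; apply: le_measure; rewrite ?inE//.
- have [F FP] : exists F : cell T -> 'rV[R]_d -> R, forall K, continuous (F K) /\
      forall x, U K x -> f x = F K x.
    have /choice[F FP] : forall K, exists F, continuous F /\ forall x, U K x -> f x = F x.
      by move=> K; have [F ? ?] := pf K; exists F.
    by exists F.
  move=> _ Y mY.
  (* On this domain the preimage splits over the finitely many cells, where [f] may be replaced by
     its continuous representative. *)
  rewrite [X in measurable X](_ : _ = \bigcup_(K in [set: cell T]) ((@to_rV R d @^-1` cube a l `\` N) `&`
      (@to_rV R d @^-1` U K) `&` ((F K \o @to_rV R d) @^-1` Y))); last first.
    apply/seteqP; split=> [x [Ex /= fx]|x [K _ [[Ex Ux] Fx]]].
      have [K _ Ux] := EU _ Ex; exists K => //; split => //=.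
      by have [_ <-] := FP K.
    by split => //=; have [_ ->] := FP K.
  apply: fin_bigcup_measurable => // K _; apply: measurableI.
    by apply: measurableI => //; apply: measurable_to_rV_open; exact: oU.
  rewrite -[Y in measurable Y]setTI; apply: measurable_continuous_to_rV => //.
  by have [] := FP K.
- have /choice[M MP] : forall K, exists M, forall x, U K x -> `|f x| <= M.
    move=> K; have [F cF fE] := pf K.
    have [M HM] := continuous_bounded_cube F cF.
    by exists M => x Ux; rewrite fE//; apply: HM; exact: cU Ux.
  exists (\sum_K `|M K|); split; first exact: num_real.
  move=> y My x /= Ex; apply: le_trans (ltW My).
  have [K _ Ux] := EU _ Ex; apply: le_trans (MP _ _ Ux) _.
  rewrite (bigD1 K)//=; apply: le_trans (ler_norm _) _.
  by rewrite lerDl sumr_ge0.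
Qed.

Local Notation I := (integral_on (cube a l)).

Lemma integral_eq_cells f g : (forall K x, U K x -> f x = g x) -> I f = I g.
Proof.
move=> fg; have [E [_ EU _ [IE _]]] := conull_domain; rewrite !IE.
by apply: eq_Rintegral => x /[1!inE] /EU [K _ /fg].
Qed.

Lemma integral_add_cells f g :
  piecewise_continuous f -> piecewise_continuous g ->
  I (fun x => f x + g x) = I f + I g.
Proof.
move=> pf pg; have [E [mE _ _ [IE ii]]] := conull_domain; rewrite !IE.
by apply: RintegralD => //; exact: ii.
Qed.

Lemma integral_scale_cells (c : R) f : piecewise_continuous f ->
  I (fun x => c * f x) = c * I f.
Proof.
move=> pf; have [E [mE _ _ [IE ii]]] := conull_domain; rewrite !IE.
by apply: RintegralZl => //; exact: ii.
Qed.

Lemma integral_sub_cells f g :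
  piecewise_continuous f -> piecewise_continuous g ->
  I (fun x => f x - g x) = I f - I g.
Proof.
move=> pf pg; rewrite integral_add_cells//; last exact: pwcN.
congr (_ + _); rewrite -mulN1r -integral_scale_cells//.
by congr (I _); apply/funext => x; rewrite mulN1r.
Qed.

Lemma Vh_grad v : Vh l T v ->
  forall K, exists (g : 'cV[R]_d) (c : R), forall x, U K x ->
   v x = (x *m g) 0 0 + c /\ grad v x = g.
Proof.
have [oU sU _ _] := hU.
move=> [_ _ Hv] K; have [g [c vE]] := Hv K; exists g, c => x Ux; split.
  by apply: vE; exact: sU Ux.
by apply: (grad_affine (U K) _ _ c) => // y Uy; apply: vE; exact: sU Uy.
Qed.

Lemma pwc_Vh v : Vh l T v -> piecewise_continuous v.
Proof. by move=> [_ cv _]; exact: pwc_continuous. Qed.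

Lemma pwc_grad v i : Vh l T v -> piecewise_continuous (fun x => grad v x i 0).
Proof.
move=> Hv K; have [g [c vE]] := Vh_grad v Hv K.
exists (fun=> g i 0); first exact: continuous_fun_cst.
by move=> x /vE[_ ->].
Qed.

(** The claim is confined to open cells: at points of faces [grad] may consist of default values, on
    which subtraction can fail. *)
Lemma Vh_gradB v w K x : Vh l T v -> Vh l T w -> U K x ->
  grad (fun y => v y - w y) x = grad v x - grad w x.
Proof.
move=> /Vh_grad/(_ K)[g [c vE]] /Vh_grad/(_ K)[g' [c' wE]] Ux.
have [-> ->] := (proj2 (vE _ Ux), proj2 (wE _ Ux)).
have [oU _ _ _] := hU.
apply: (grad_affine (U K) _ _ (c - c')) => // y Uy.
by rewrite (proj1 (vE _ Uy)) (proj1 (wE _ Uy)) mulmxBr !mxE; ring.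
Qed.

End Cells.

Lemma Vh_cst (c : R) : Vh l T (fun=> c).
Proof.
split => //; first exact: continuous_fun_cst.
by move=> K; exists 0, c => x _; rewrite mulmx0 mxE add0r.
Qed.

Lemma VhB v w : Vh l T v -> Vh l T w -> Vh l T (fun x => v x - w x).
Proof.
move=> [pv cv av] [pw cw aw]; split.
- by move=> x k; rewrite pv pw.
- by move=> x; exact: (cvgB (cv x) (cw x)).
- move=> K; have [g [c vE]] := av K; have [g' [c' wE]] := aw K.
  by exists (g - g'), (c - c') => x Kx; rewrite vE// wE// mulmxBr !mxE; ring.
Qed.

Lemma grad_cst (c : R) x : grad (fun _ : 'rV[R]_d => c) x = 0.
Proof. by apply/colP => i; rewrite !mxE derive_cst. Qed.

Lemma cube_translate x : 0 < l -> exists k, cube a l (x + lattice_vector l k).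
Proof.
(* Subtracting the integer part of [(x 0 i - a 0 i) / l], in units of [l], brings each coordinate
   into the cube. *)
move=> l0; exists (fun i => - Num.floor ((x 0 i - a 0 i) / l)) => i.
rewrite !mxE mulrNz.
have := floor_itv ((x 0 i - a 0 i) / l).
rewrite ler_pdivlMr// ltr_pdivrMr// intrD mulrDl => /andP[h1 h2].
apply/andP; split; lra.
Qed.

(** Periodicity carries positivity from the cube to the whole space, so potentials evaluated along
    the discrete solution are continuous everywhere. *)
Lemma Vh_pos_gt0 v x : 0 < l -> Vh_pos a l T v -> 0 < v x.
Proof.
move=> /(cube_translate x)[k ck] [[pv _ _] vpos].
by rewrite -(pv x k); exact: vpos.
Qed.

End Mesh.

(** * Thermodynamic potentials *)

Section Potentials.
Context {R : realType}.
Notation state := (@state R).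
Notation dirs := [set @dir_rho R; @dir_theta R; @dir_eta R].
Notation pos := (@positive_temperature R).
Implicit Types (f : state -> R) (z : state).

Lemma open_positive_temperature : open pos.
Proof.
apply: (@open_comp _ _ (fun z : state => z.1.2) [set x | 0 < x]); last exact: open_gt.
move=> z _; apply: (@continuous_comp _ _ _ (fst : state -> (R * R)%type) snd).
  exact: cvg_fst.
exact: cvg_snd.
Qed.

Lemma positive_temperature_near z : pos z -> \forall y \near z, pos y.
Proof. by move=> pz; apply: open_nbhs_nbhs; split => //; exact: open_positive_temperature. Qed.

Lemma smooth_continuous f z : smooth_potential f -> pos z -> {for z, continuous f}.
Proof. by move=> /(_ 0%N)[cf _] /cf. Qed.

Lemma smooth_derivable f z v : smooth_potential f -> dirs v -> pos z ->
  derivable f z v.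
Proof. by move=> /(_ 1%N)[_ /(_ v)df] /df[{}df _] /df. Qed.

Lemma smooth_derive f v : smooth_potential f -> dirs v ->
  smooth_potential ('D_v f).
Proof. by move=> sf dv k; have [_ /(_ _ dv)[_]] := sf k.+1. Qed.

Lemma dirs_rho : dirs dir_rho. Proof. by left; left. Qed.
Lemma dirs_theta : dirs dir_theta. Proof. by left; right. Qed.
Lemma dirs_eta : dirs dir_eta. Proof. by right. Qed.

Lemma is_derive_rho_eta f z (a b : R) : smooth_potential f -> pos z ->
  is_derive z (a, 0, b) f (a * d_rho f z + b * d_eta f z).
Proof.
move=> sf pz.
have -> : (a, 0, b) = a *: dir_rho + b *: dir_eta :> state.
  rewrite /dir_rho /dir_eta; congr (_, _, _); rewrite /= /GRing.scale/=; ring.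
apply: is_derive_comb.
- by apply: smooth_derivable => //; exact: dirs_rho.
- apply: filterS (positive_temperature_near _ pz) => y py.
  by apply: smooth_derivable => //; exact: dirs_eta.
- by apply: smooth_continuous => //; apply: smooth_derive => //; exact: dirs_eta.
Qed.

Lemma is_derive_theta f z (a : R) : smooth_potential f -> pos z ->
  is_derive z (0, a, 0) f (a * d_theta f z).
Proof.
move=> sf pz.
have -> : (0, a, 0) = a *: dir_theta :> state.
  rewrite /dir_theta; congr (_, _, _); rewrite /= /GRing.scale/=; ring.
apply: is_derive_scale; apply: derivableP.
by apply: smooth_derivable => //; exact: dirs_theta.
Qed.

Lemma between_line (x y t : R) : 0 < t < 1 -> between x y (t * (y - x) + x).
Proof.
by move=> /andP[t0 t1]; rewrite /between; case: (lerP x y) => xy;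
  apply/andP; split; nra.
Qed.

Lemma between_sym (x y c : R) : between x y c -> between y x c.
Proof. by rewrite /between minC maxC. Qed.

(** Taylor's formula solved for the second-order term. The right-hand side does not involve [xi],
    which later gives continuity of the defect in [x]. *)
Lemma theta_taylor f (r e t0 t1 : R) : smooth_potential f -> 0 < t0 -> 0 < t1 ->
  exists2 xi, between t0 t1 xi &
    d_theta (d_theta f) (r, xi, e) * (t1 - t0) * (t1 - t0) =
    2 * (f (r, t1, e) - f (r, t0, e) - d_theta f (r, t0, e) * (t1 - t0)).
Proof.
move=> sf t00 t10.
have lineE (t : R) : t *: ((0, t1 - t0, 0) : state) + (r, t0, e)
    = (r, t * (t1 - t0) + t0, e).
  by congr (_, _, _); rewrite /= /GRing.scale/=; ring.
have posl (t : R) : 0 <= t <= 1 -> pos (t *: ((0, t1 - t0, 0) : state) + (r, t0, e)).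
  move=> /andP[h0 h1]; rewrite lineE /positive_temperature/=.
  have [->|tn0] := eqVneq t 0; first by rewrite mul0r add0r.
  have : 0 < t * t1 by rewrite mulr_gt0// lt_neqAle eq_sym tn0.
  have : 0 <= (1 - t) * t0 by rewrite mulr_ge0 ?subr_ge0// ltW.
  by lra.
have sD : smooth_potential (d_theta f) by apply: smooth_derive => //; exact: dirs_theta.
have [||c c01] := @taylor2_line R state f (fun y => (t1 - t0) * d_theta f y)
  (fun y => (t1 - t0) * ((t1 - t0) * d_theta (d_theta f) y)) (r, t0, e) (0, t1 - t0, 0).
- by move=> t /posl pt; exact: is_derive_theta.
- move=> t /posl pt.
  have := @is_deriveZ _ _ _ (d_theta f) (t1 - t0) _ _ _ (is_derive_theta _ _ (t1 - t0) sD pt).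
  exact.
have -> : (0, t1 - t0, 0) + (r, t0, e) = (r, t1, e) :> state.
  by congr (_, _, _); rewrite /=; ring.
rewrite lineE => E; exists (c * (t1 - t0) + t0); first exact: between_line.
by rewrite E; field.
Qed.

Lemma quad2E (A : 'M[R]_2) (x y : R) :
  let u : 'cV[R]_2 := \col_i (if i == 0 then x else y) in
  dot (A *m u) u = A 0 0 * x * x + (A 0 1 + A 1 0) * x * y + A 1 1 * y * y.
Proof.
rewrite /dot /= mxE !big_ord_recl big_ord0 !mxE !big_ord_recl !big_ord0 !mxE.
rewrite !(eqxx, lift0) /=.
have -> : lift ord0 ord0 = 1 :> 'I_2 by exact/val_inj.
have -> : (ord0 : 'I_2) = 0 by [].
rewrite /=; ring.
Qed.

(** Quadratic forms are even; the second one is written with negated increments because [psi_vex] is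
    expanded from the new level back to the old one. *)
Lemma quad2BE (A B : 'M[R]_2) (x y : R) :
  let u : 'cV[R]_2 := \col_i (if i == 0 then x else y) in
  dot ((A - B) *m u) u =
  (A 0 0 * x * x + (A 0 1 + A 1 0) * x * y + A 1 1 * y * y) -
  (B 0 0 * (- x) * (- x) + (B 0 1 + B 1 0) * (- x) * (- y) + B 1 1 * (- y) * (- y)).
Proof. by rewrite /= quad2E !mxE; ring. Qed.

Lemma hessianE f z : [/\ hessian f z 0 0 = d_rho (d_rho f) z,
  hessian f z 0 1 = d_eta (d_rho f) z, hessian f z 1 0 = d_rho (d_eta f) z &
  hessian f z 1 1 = d_eta (d_eta f) z].
Proof. by split; rewrite mxE. Qed.

(** One parameter [c] on the segment provides both [chi] and [chi']. The mixed derivatives come from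
    two different entries and enter through their sum. *)
Lemma rho_eta_taylor f (th r0 r1 e0 e1 : R) : smooth_potential f -> 0 < th ->
  exists chi chi', [/\ between r0 r1 chi, between e0 e1 chi' &
    let H := hessian f (chi, th, chi') in
    H 0 0 * (r1 - r0) * (r1 - r0) + (H 0 1 + H 1 0) * (r1 - r0) * (e1 - e0)
      + H 1 1 * (e1 - e0) * (e1 - e0) =
    2 * (f (r1, th, e1) - f (r0, th, e0)
      - (d_rho f (r0, th, e0) * (r1 - r0) + d_eta f (r0, th, e0) * (e1 - e0)))].
Proof.
move=> sf th0; set x := r1 - r0; set y := e1 - e0.
have lineE (t : R) : t *: ((x, 0, y) : state) + (r0, th, e0)
    = (t * x + r0, th, t * y + e0).
  by congr (_, _, _); rewrite /= /GRing.scale/=; ring.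
have posl (t : R) : pos (t *: ((x, 0, y) : state) + (r0, th, e0)).
  by rewrite lineE.
have sr : smooth_potential (d_rho f) by apply: smooth_derive => //; exact: dirs_rho.
have se : smooth_potential (d_eta f) by apply: smooth_derive => //; exact: dirs_eta.
have [||c c01] := @taylor2_line R state f (fun z => x * d_rho f z + y * d_eta f z)
  (fun z => x * (x * d_rho (d_rho f) z + y * d_eta (d_rho f) z) +
            y * (x * d_rho (d_eta f) z + y * d_eta (d_eta f) z))
  (r0, th, e0) (x, 0, y).
- by move=> t _; exact: is_derive_rho_eta.
- move=> t _.
  have D1 := @is_deriveZ _ _ _ (d_rho f) x _ _ _ (is_derive_rho_eta _ _ x y sr (posl t)).
  have D2 := @is_deriveZ _ _ _ (d_eta f) y _ _ _ (is_derive_rho_eta _ _ x y se (posl t)).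
  exact: (is_deriveD D1 D2).
have -> : (x, 0, y) + (r0, th, e0) = (r1, th, e1) :> state.
  by congr (_, _, _); rewrite /= /x /y; ring.
rewrite lineE => E; exists (c * x + r0), (c * y + e0).
split; [exact: between_line|exact: between_line|].
have [h00 h01 h10 h11] := hessianE f (c * x + r0, th, c * y + e0).
cbv zeta; rewrite h00 h01 h10 h11 {}E.
set p := (c * x + r0, th, c * y + e0).
move: (d_rho (d_rho f) p) (d_eta (d_rho f) p) (d_rho (d_eta f) p)
  (d_eta (d_eta f) p) (d_rho f (r0, th, e0)) (d_eta f (r0, th, e0)) (f (r0, th, e0)).
by move=> *; field.
Qed.

(** Leaving [df] abstract lets the inequality serve both [psi_vex] and the negative of [psi_cav]. *)
Lemma convex_rho_eta_tangent f (th r0 r1 e0 e1 df : R) :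
  convex_in_rho_eta f -> 0 < th ->
  is_derive ((r0, th, e0) : state) (r1 - r0, 0, e1 - e0) f df ->
  df <= f (r1, th, e1) - f (r0, th, e0).
Proof.
move=> cf th0 D.
have := derive_le_convex _ _ _ _ D.
have -> : (r1 - r0, 0, e1 - e0) + (r0, th, e0) = (r1, th, e1) :> state.
  by congr (_, _, _); rewrite /=; ring.
apply => t /andP[t0 t1].
have -> : t *: ((r1 - r0, 0, e1 - e0) : state) + (r0, th, e0)
    = (t * r1 + (1 - t) * r0, th, t * e1 + (1 - t) * e0).
  by congr (_, _, _); rewrite /= /GRing.scale/=; ring.
have := cf th th0 (Itv01 (ltW t0) (ltW t1)) (r1, e1) (r0, e0) (in_setT _) (in_setT _).
rewrite [leRHS]addrC; exact.
Qed.

Lemma concave_theta_tangent f (r e t0 t1 : R) : smooth_potential f ->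
  concave_in_theta f -> 0 < t0 -> 0 < t1 ->
  f (r, t1, e) - f (r, t0, e) <= d_theta f (r, t0, e) * (t1 - t0).
Proof.
move=> sf cf t00 t10.
have D := is_derive_theta f (r, t0, e) (t1 - t0) sf t00.
have := derive_le_convex _ _ _ _ (is_deriveN D).
have -> : (0, t1 - t0, 0) + (r, t0, e) = (r, t1, e) :> state.
  by congr (_, _, _); rewrite /=; ring.
rewrite !fctE => H.
have : - ((t1 - t0) * d_theta f (r, t0, e)) <= - f (r, t1, e) - - f (r, t0, e).
  apply: H => t /andP[h0 h1].
  have -> : t *: ((0, t1 - t0, 0) : state) + (r, t0, e)
      = (r, t * t1 + (1 - t) * t0, e).
    by congr (_, _, _); rewrite /= /GRing.scale/=; ring.
  have := cf r e (Itv01 (ltW h0) (ltW h1)) t1 t0.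
  rewrite !inE/= => /(_ t10 t00).
  rewrite [leRHS]addrC; exact.
lra.
Qed.

End Potentials.

(** * Dot products and the mobility quadratic form *)

Section DotProduct.
Context {R : realType} {d : nat}.
Implicit Types u v w : 'cV[R]_d.

Lemma dotE u v : dot u v = \sum_i u i 0 * v i 0.
Proof. by rewrite /dot mxE; apply: eq_bigr => i _; rewrite mxE. Qed.

Lemma dotC u v : dot u v = dot v u.
Proof. by rewrite !dotE; apply: eq_bigr => i _; rewrite mulrC. Qed.

Lemma dotDl u v w : dot (u + v) w = dot u w + dot v w.
Proof. by rewrite /dot linearD/= mulmxDl mxE. Qed.

Lemma dotNl u v : dot (- u) v = - dot u v.
Proof. by rewrite /dot linearN/= mulNmx mxE. Qed.

Lemma dotZl (c : R) u v : dot (c *: u) v = c * dot u v.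
Proof. by rewrite /dot linearZ/= -scalemxAl mxE. Qed.

Lemma dotDr u v w : dot w (u + v) = dot w u + dot w v.
Proof. by rewrite ![dot w _]dotC dotDl. Qed.

Lemma dotNr u v : dot u (- v) = - dot u v.
Proof. by rewrite dotC dotNl dotC. Qed.

Lemma dot0r u : dot u 0 = 0.
Proof. by rewrite /dot mulmx0 mxE. Qed.

Lemma dot_ge0 u : 0 <= dot u u.
Proof. by rewrite dotE sumr_ge0// => i _; rewrite -expr2 sqr_ge0. Qed.

(** The summands are the flux terms of the tested balance laws. The second block row yields the
    negative of the energy flux, whence the minus sign. *)
Lemma dot_block_mx (A B C : 'M[R]_d) (p q u v : 'cV[R]_d) (s m : R) :
  let g : 'cV[R]_(d + d + 1) := col_mx (col_mx u v) m%:M in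
  dot g (block_mx (block_mx A (- B) (- B) C) (col_mx p (- q))
           (row_mx p^T (- q^T)) s%:M *m g)
  = dot (A *m u - B *m v + m *: p) u - dot (B *m u - C *m v + m *: q) v
    + (dot p u - dot q v + s * m) * m.
Proof.
move=> g; rewrite /g mul_block_col mul_block_col mul_row_col {1}/dot.
rewrite !tr_col_mx mul_row_col mul_mx_scalar mulNmx.
rewrite scale_col_mx add_col_mx mul_row_col tr_scalar_mx mul_scalar_mx.
rewrite -scalar_mxM !mxE eqxx mulr1n.
rewrite !mulNmx scalerN.
have -> : \sum_j u^T 0 j * (A *m u - B *m v + m *: p) j 0 = dot u (A *m u - B *m v + m *: p).
  by rewrite /dot mxE.
have -> : \sum_j v^T 0 j * (- (B *m u) + C *m v - m *: q) j 0 = dot v (- (B *m u) + C *m v - m *: q).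
  by rewrite /dot mxE.
have -> : \sum_j p^T 0 j * u j 0 = dot p u by rewrite /dot mxE.
have -> : \sum_j (- q^T) 0 j * v j 0 = - dot q v by rewrite -dotNl /dot linearN mxE.
rewrite !dotDr !dotNr !dotDl !dotNl ![dot v _]dotC ![dot u _]dotC !dotZl; ring.
Qed.

End DotProduct.

(** * Linear relations between integrals *)

Section LinearRelations.
Context {R : realType} {d : nat} {a : 'rV[R]_d} {l : R} {T : @mesh R d}.
Context {U : cell T -> set 'rV[R]_d} (hU : open_cells a l T U).
Local Notation I := (integral_on (cube a l)).
Local Notation pwc := (piecewise_continuous T U).

(** Weighted lists let one pointwise identity with many terms be integrated at once, given piecewise
    continuity of each term. *)
Lemma integral_linear_combination (s : seq (R * ('rV[R]_d -> R))) :
  foldr (fun p P => pwc p.2 /\ P) True s ->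
  I (fun x => \sum_(p <- s) p.1 * p.2 x) = \sum_(p <- s) p.1 * I p.2.
Proof.
(* Additivity at each step needs the partial sum to be piecewise continuous, so the induction
   carries this along. *)
suff H : foldr (fun p P => pwc p.2 /\ P) True s ->
    pwc (fun x => \sum_(p <- s) p.1 * p.2 x) /\
    I (fun x => \sum_(p <- s) p.1 * p.2 x) = \sum_(p <- s) p.1 * I p.2.
  by move=> /H[].
elim: s => [_|p s IH /= [pp /IH[ps E]]].
  under eq_fun do rewrite big_nil; rewrite big_nil; split; first exact: pwc_cst.
  rewrite -[RHS](mul0r (I (fun=> 0))) -(integral_scale_cells _ _ _ U)//; last exact: pwc_cst.
  by congr (I _); apply/funext => x; rewrite mul0r.
under eq_fun do rewrite big_cons; rewrite big_cons.
have pp' : pwc (fun x => p.1 * p.2 x) by exact: pwcZ.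
split; first exact: pwcD.
by rewrite (integral_add_cells _ _ _ U)// (integral_scale_cells _ _ _ U)// E.
Qed.

Lemma integral_linear_relation (s : seq (R * ('rV[R]_d -> R))) :
  foldr (fun p P => pwc p.2 /\ P) True s ->
  (forall K x, U K x -> \sum_(p <- s) p.1 * p.2 x = 0) ->
  \sum_(p <- s) p.1 * I p.2 = 0.
Proof.
move=> ps s0; rewrite -integral_linear_combination//.
rewrite (integral_eq_cells _ _ _ U hU _ (fun x => \sum_(p <- [::] : seq (R * ('rV[R]_d -> R))) p.1 * p.2 x)).
  by rewrite integral_linear_combination// big_nil.
by move=> K x /s0 ->; rewrite big_nil.
Qed.

Definition pwc_mx {m n} (A : 'rV[R]_d -> 'M[R]_(m, n)) :=
  forall i j, pwc (fun x => A x i j).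

Lemma pwc_mxM m n p (A : 'rV[R]_d -> 'M[R]_(m, n)) (B : 'rV[R]_d -> 'M[R]_(n, p)) :
  pwc_mx A -> pwc_mx B -> pwc_mx (fun x => A x *m B x).
Proof.
move=> pA pB i j; under eq_fun do rewrite mxE.
by apply: pwc_sum => k; exact: pwcM.
Qed.

Lemma pwc_mxD m n (A B : 'rV[R]_d -> 'M[R]_(m, n)) :
  pwc_mx A -> pwc_mx B -> pwc_mx (fun x => A x + B x).
Proof. by move=> pA pB i j; under eq_fun do rewrite mxE; exact: pwcD. Qed.

Lemma pwc_mxB m n (A B : 'rV[R]_d -> 'M[R]_(m, n)) :
  pwc_mx A -> pwc_mx B -> pwc_mx (fun x => A x - B x).
Proof. by move=> pA pB i j; under eq_fun do rewrite !mxE; exact: pwcB. Qed.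

Lemma pwc_mxZ m n (c : 'rV[R]_d -> R) (A : 'rV[R]_d -> 'M[R]_(m, n)) :
  pwc c -> pwc_mx A -> pwc_mx (fun x => c x *: A x).
Proof. by move=> pc pA i j; under eq_fun do rewrite mxE; exact: pwcM. Qed.

Lemma pwc_dot (u v : 'rV[R]_d -> 'cV[R]_d) :
  pwc_mx u -> pwc_mx v -> pwc (fun x => dot (u x) (v x)).
Proof.
move=> pu pv; under eq_fun do rewrite dotE.
by apply: pwc_sum => k; exact: pwcM.
Qed.

Lemma pwc_mx_grad v : Vh l T v -> pwc_mx (grad v).
Proof. by move=> Hv i j; rewrite ord1; exact: (pwc_grad a l T U hU). Qed.

(** The gradient of a constant is 0 at every point, so the flux integrand vanishes identically
    whatever [F] is, and only the time difference remains. *)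
Lemma conserved_integral (tau : R) (f g : 'rV[R]_d -> R) (F : 'rV[R]_d -> 'cV[R]_d) :
  tau != 0 -> continuous f -> continuous g ->
  ip a l (fun x => (g x - f x) / tau) (fun=> 1) + ipv a l F (grad (fun=> 1)) = 0 ->
  ip a l g (fun=> 1) = ip a l f (fun=> 1).
Proof.
move=> tau0 cf cg; rewrite /ip /ipv => E.
have F0 : I (fun x => dot (F x) (grad (fun=> 1) x)) = 0.
  rewrite -[RHS](mul0r (I (fun=> 0))) -(integral_scale_cells _ _ _ U)//; last exact: pwc_cst.
  by congr (I _); apply/funext => x; rewrite grad_cst dot0r mul0r.
move: E; rewrite F0 addr0 => E.
have := integral_linear_relation
  [:: (1, fun x => (g x - f x) / tau * 1); (- tau^-1, fun x => g x * 1);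
      (tau^-1, fun x => f x * 1)].
rewrite !big_cons big_nil /= E mulr0 add0r addr0 => H.
apply: (mulfI (invr_neq0 tau0)); apply/esym/eqP; rewrite -subr_eq0 addrC -mulNr.
apply/eqP; apply: H.
  have pf := pwc_continuous T U f cf; have pg := pwc_continuous T U g cg.
  have p1 := pwc_cst T U 1.
  split; last by split; [exact: pwcM|split => //; exact: pwcM].
  by apply: pwcM => //; apply: pwcM; [exact: pwcB|exact: pwc_cst].
by move=> K x _; rewrite !big_cons big_nil /=; field.
Qed.

End LinearRelations.

(** * The mobility along a discrete solution *)

Section MobilityContinuity.
Context {R : realType} {d : nat}.

Lemma Ck_continuous (V : normedModType R) (E W : set V) k (f : V -> R) z :
  Ck E W k f -> W z -> {for z, continuous f}.
Proof. by case: k => [|k] [cf _] /cf. Qed.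

Context {a : 'rV[R]_d} {l : R} {T : @mesh R d}.
Context {U : cell T -> set 'rV[R]_d} (hU : open_cells a l T U).
Variables (tau : R) (L : @mobility R d) (lam0 lam1 : R).
Variables (hL : admissible_mobility L lam0 lam1) (w_old w_new : 'I_5 -> R).
Variables (rho theta eta : R -> 'rV[R]_d -> R) (n : nat).
Hypothesis Hrho : forall m, (m <= n.+1)%N -> Vh l T (lev tau rho m).
Hypothesis Htheta : forall m, (m <= n.+1)%N -> Vh l T (lev tau theta m).
Hypothesis Heta : forall m, (m <= n.+1)%N -> Vh l T (lev tau eta m).
Local Notation z := (mob_arg_at tau w_old w_new rho theta eta n).
Local Notation pwc := (piecewise_continuous T U).

Lemma pwc_mob_matrix : pwc_mx (T := T) (U := U) (fun x => mob_matrix L (z x)).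
Proof.
move=> i j K.
have [_ _ _ /(_ i j) cL _] := hL.
have nn : (n <= n.+1)%N by [].
have [g0 [c0 H0]] := Vh_grad a l T U hU _ (Hrho n nn) K.
have [g1 [c1 H1]] := Vh_grad a l T U hU _ (Hrho n.+1 (leqnn _)) K.
have [g2 [c2 H2]] := Vh_grad a l T U hU _ (Heta n nn) K.
have [g3 [c3 H3]] := Vh_grad a l T U hU _ (Heta n.+1 (leqnn _)) K.
pose comb k (f g : 'rV[R]_d -> R) x := w_old k * f x + w_new k * g x.
(* On the cell the gradients are the constants [g0] to [g3]; putting these in makes the argument of
   the mobility continuous on the whole space. *)
pose Z x : @mob_arg R d := (comb (inord 0) (lev tau rho n) (lev tau rho n.+1) x,
  w_old (inord 1) *: g0 + w_new (inord 1) *: g1,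
  comb (inord 2) (lev tau theta n) (lev tau theta n.+1) x,
  comb (inord 3) (lev tau eta n) (lev tau eta n.+1) x,
  w_old (inord 4) *: g2 + w_new (inord 4) *: g3).
exists (fun x => mob_matrix L (Z x) i j); last first.
  move=> x Ux; rewrite /mob_arg_at /Z.
  by rewrite (proj2 (H0 _ Ux)) (proj2 (H1 _ Ux)) (proj2 (H2 _ Ux)) (proj2 (H3 _ Ux)).
have cc k f g : Vh l T f -> Vh l T g -> continuous (comb k f g).
  move=> [_ cf _] [_ cg _]; apply: continuous_funD; apply: continuous_funM => //;
  exact: continuous_fun_cst.
move=> x; apply: (@continuous_comp _ _ _ Z (fun z => mob_matrix L z i j)); last first.
  exact: Ck_continuous cL I.
have c4 := @cst_continuous 'rV[R]_d 'cV[R]_d (w_old (inord 4) *: g2 + w_new (inord 4) *: g3) x.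
have c1' := @cst_continuous 'rV[R]_d 'cV[R]_d (w_old (inord 1) *: g0 + w_new (inord 1) *: g1) x.
have cr := cc (inord 0) _ _ (Hrho n nn) (Hrho n.+1 (leqnn _)) x.
have ct := cc (inord 2) _ _ (Htheta n nn) (Htheta n.+1 (leqnn _)) x.
have ce := cc (inord 3) _ _ (Heta n nn) (Heta n.+1 (leqnn _)) x.
exact: (cvg_pair (cvg_pair (cvg_pair (cvg_pair cr c1') ct) ce) c4).
Qed.

(** Regularity is assumed for the entries of the assembled matrix; this block and the following ones
    are read off at the matching indices, with a sign change for [L12] and [L23]. *)
Lemma pwc_L11 : pwc_mx (T := T) (U := U) (fun x => L11 L (z x)).
Proof.
move=> i j; have := pwc_mob_matrix (lshift 1 (lshift d i)) (lshift 1 (lshift d j)).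
by congr pwc; apply/funext => x; rewrite /mob_matrix !block_mxEul.
Qed.

Lemma pwc_L22 : pwc_mx (T := T) (U := U) (fun x => L22 L (z x)).
Proof.
move=> i j; have := pwc_mob_matrix (lshift 1 (rshift d i)) (lshift 1 (rshift d j)).
by congr pwc; apply/funext => x; rewrite /mob_matrix block_mxEul block_mxEdr.
Qed.

Lemma pwc_L12 : pwc_mx (T := T) (U := U) (fun x => L12 L (z x)).
Proof.
move=> i j; have := pwcN T U _ (pwc_mob_matrix (lshift 1 (lshift d i)) (lshift 1 (rshift d j))).
by congr pwc; apply/funext => x; rewrite /mob_matrix block_mxEul block_mxEur mxE opprK.
Qed.

Lemma pwc_L13 : pwc_mx (T := T) (U := U) (fun x => L13 L (z x)).
Proof.
move=> i j; have := pwc_mob_matrix (lshift 1 (lshift d i)) (rshift (d + d) j).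
by congr pwc; apply/funext => x; rewrite /mob_matrix block_mxEur col_mxEu.
Qed.

Lemma pwc_L23 : pwc_mx (T := T) (U := U) (fun x => L23 L (z x)).
Proof.
move=> i j; have := pwcN T U _ (pwc_mob_matrix (lshift 1 (rshift d i)) (rshift (d + d) j)).
by congr pwc; apply/funext => x; rewrite /mob_matrix block_mxEur col_mxEd mxE opprK.
Qed.

Lemma pwc_L33 : pwc (fun x => L33 L (z x)).
Proof.
have := pwc_mob_matrix (rshift (d + d) 0) (rshift (d + d) 0).
by congr pwc; apply/funext => x; rewrite /mob_matrix block_mxEdr mxE eqxx.
Qed.

End MobilityContinuity.

(** * The entropy balance of one time step *)

Lemma num_dissipation_sign (R : realType) (p q r s : R) :
  0 <= p -> 0 <= q -> r <= 0 -> s <= 0 -> 0 <= p + q - 1 / 2 * r - 1 / 2 * s.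
Proof. lra. Qed.

(** The long equation is the integrated pointwise identity; [S1] to [S5] are the tested equations.
    [E], [Jr], [Je] pair [theta], [mu_rho], [mu_eta] with the increments of energy, [rho], [eta],
    and [F1], [F3], [F4] are the flux terms. *)
Lemma entropy_step_algebra (R : realType)
  (tau gr ge s1 s0 Gr Ge TD HD E J1 J2 P Q Jr Je F1 F3 F4 : R) :
  tau != 0 ->
  1 * s1 + (- 1 * s0 + (- (gr / 2) * Gr + (- (ge / 2) * Ge + (1 / 2 * TD +
    (1 / 2 * HD + (- 1 * E + (gr * J1 + (ge * J2 + (1 * P + (1 * Q + 0))))))))))
    = 0 ->
  tau^-1 * Jr + F1 = 0 -> Jr - gr * J1 - P = 0 -> tau^-1 * E + F3 = 0 ->
  tau^-1 * Je + F4 = 0 -> Je - ge * J2 - Q = 0 ->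
  s1 = s0 + (gr / 2 * Gr + ge / 2 * Ge - 1 / 2 * TD - 1 / 2 * HD)
       + tau * (F1 - F3 + F4).
Proof.
move=> tau0 REL S1 S2 S3 S4 S5.
have -> : tau * (F1 - F3 + F4) = E - Jr - Je.
  have {}S1 : F1 = - (tau^-1 * Jr) by lra.
  have {}S3 : F3 = - (tau^-1 * E) by lra.
  have {}S4 : F4 = - (tau^-1 * Je) by lra.
  by rewrite S1 S3 S4; field.
lra.
Qed.

Section EntropyStep.
Context {R : realType} {d : nat} {a : 'rV[R]_d} {l : R} {T : @mesh R d}.
Context {U : cell T -> set 'rV[R]_d} (hU : open_cells a l T U).
Variables (tau gamma_rho gamma_eta : R).
Variables (psi psi_vex psi_cav : @state R -> R).
Variables (L : @mobility R d) (lam0 lam1 : R) (w_old w_new : 'I_5 -> R).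
Variables (rho theta eta mu_rho mu_eta : R -> 'rV[R]_d -> R) (n : nat).
Hypotheses (l_gt0 : 0 < l) (tau_neq0 : tau != 0).
Hypotheses (gamma_rho_gt0 : 0 < gamma_rho) (gamma_eta_gt0 : 0 < gamma_eta).
Hypothesis hL : admissible_mobility L lam0 lam1.
Hypothesis hpsi : admissible_potential psi psi_vex psi_cav.
Hypothesis Vh_rho : forall m, (m <= n.+1)%N -> Vh l T (lev tau rho m).
Hypothesis Vh_theta : forall m, (m <= n.+1)%N -> Vh_pos a l T (lev tau theta m).
Hypothesis Vh_eta : forall m, (m <= n.+1)%N -> Vh l T (lev tau eta m).
Hypothesis Vh_mu_rho : Vh l T (lev tau mu_rho n.+1).
Hypothesis Vh_mu_eta : Vh l T (lev tau mu_eta n.+1).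
Hypothesis step : scheme_step a l T tau gamma_rho gamma_eta psi psi_vex psi_cav L
  w_old w_new rho theta eta mu_rho mu_eta n.

Local Notation I := (integral_on (cube a l)).
Local Notation pwc := (piecewise_continuous T U).
Local Notation st := (state_at tau rho theta eta).
Local Notation mixed := (fun x =>
  (lev tau rho n x, lev tau theta n.+1 x, lev tau eta n x) : @state R).
Local Notation dr := (dlev tau rho n).
Local Notation dt := (dlev tau theta n).
Local Notation de := (dlev tau eta n).

(** The increment of [psi] over the step is split at [mixed]: here [theta] moves while [rho] and
    [eta] stay at the old level. *)
Definition theta_remainder x : R :=
  2 * (psi (mixed x) - psi (st n x) - d_theta psi (st n x) * dt x).

(** Now [rho] and [eta] move at the new [theta]. The base points, [mixed] for [psi_cav] and the new
    state for [psi_vex], are those at which the scheme evaluates the derivatives. *)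
Definition rho_eta_remainder x : R :=
  2 * (psi_cav (st n.+1 x) - psi_cav (mixed x)
       - (d_rho psi_cav (mixed x) * dr x + d_eta psi_cav (mixed x) * de x))
  - 2 * (psi_vex (mixed x) - psi_vex (st n.+1 x)
       + (d_rho psi_vex (st n.+1 x) * dr x + d_eta psi_vex (st n.+1 x) * de x)).

Let smooth_psi : smooth_potential psi. Proof. by case: hpsi => -[]. Qed.
Let smooth_vex : smooth_potential psi_vex. Proof. by case: hpsi => -[]. Qed.
Let smooth_cav : smooth_potential psi_cav. Proof. by case: hpsi => -[]. Qed.

Let theta_gt0 m x : (m <= n.+1)%N -> 0 < lev tau theta m x.
Proof. by move=> /Vh_theta; exact: Vh_pos_gt0. Qed.

Let le_n : (n <= n.+1)%N. Proof. by []. Qed.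
Let le_n1 : (n.+1 <= n.+1)%N. Proof. by []. Qed.

(** Constant functions suffice at a fixed [x], because the defects at [x] only see the values
    there. *)
Lemma intermediate_values x : exists xi chi1 chi2 chi3 chi4 : R,
  [/\ between (lev tau theta n x) (lev tau theta n.+1 x) xi,
      between (lev tau rho n x) (lev tau rho n.+1 x) chi1 /\
        between (lev tau rho n x) (lev tau rho n.+1 x) chi3,
      between (lev tau eta n x) (lev tau eta n.+1 x) chi2 /\
        between (lev tau eta n x) (lev tau eta n.+1 x) chi4,
      theta_defect tau psi rho theta eta n (fun=> xi) x = theta_remainder x &
      hessian_defect tau psi_vex psi_cav rho theta eta n
        (fun=> chi1) (fun=> chi2) (fun=> chi3) (fun=> chi4) x
      = rho_eta_remainder x].
Proof.
have [xi bxi Exi] := theta_taylor psi (lev tau rho n x) (lev tau eta n x) _ _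
  smooth_psi (theta_gt0 n x le_n) (theta_gt0 n.+1 x le_n1).
have [chi1 [chi2 [b1 b2 E12]]] := rho_eta_taylor psi_cav (lev tau theta n.+1 x)
  (lev tau rho n x) (lev tau rho n.+1 x) (lev tau eta n x) (lev tau eta n.+1 x)
  smooth_cav (theta_gt0 n.+1 x le_n1).
(* Old and new levels are exchanged here, since the base point is the new state. *)
have [chi3 [chi4 [b3 b4 E34]]] := rho_eta_taylor psi_vex (lev tau theta n.+1 x)
  (lev tau rho n.+1 x) (lev tau rho n x) (lev tau eta n.+1 x) (lev tau eta n x)
  smooth_vex (theta_gt0 n.+1 x le_n1).
exists xi, chi1, chi2, chi3, chi4; split => //.
- by split => //; exact: between_sym.
- by split => //; exact: between_sym.
rewrite /hessian_defect quad2BE !opprB E12 E34 /rho_eta_remainder /dlev /state_at.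
congr (_ - _ * _).
move: (psi_vex _) (psi_vex _) (d_rho psi_vex _) (d_eta psi_vex _) => *; ring.
Qed.

Let continuous_potential (f : @state R -> R) m1 m2 m3 : smooth_potential f ->
  (m1 <= n.+1)%N -> (m2 <= n.+1)%N -> (m3 <= n.+1)%N ->
  continuous (fun x => f (lev tau rho m1 x, lev tau theta m2 x, lev tau eta m3 x)).
Proof.
move=> sf h1 h2 h3 x.
have [_ c1 _] := Vh_rho m1 h1; have [[_ c2 _] _] := Vh_theta m2 h2.
have [_ c3 _] := Vh_eta m3 h3.
apply: (@continuous_comp _ _ _ (fun x => (lev tau rho m1 x, lev tau theta m2 x, lev tau eta m3 x) : @state R) f).
  exact: (cvg_pair (cvg_pair (c1 x) (c2 x)) (c3 x)).
by apply: smooth_continuous => //; exact: theta_gt0.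
Qed.

Let pwc_potential (f : @state R -> R) m1 m2 m3 : smooth_potential f ->
  (m1 <= n.+1)%N -> (m2 <= n.+1)%N -> (m3 <= n.+1)%N ->
  pwc (fun x => f (lev tau rho m1 x, lev tau theta m2 x, lev tau eta m3 x)).
Proof. by move=> *; apply: pwc_continuous; exact: continuous_potential. Qed.

Lemma continuous_energy m : (m <= n.+1)%N ->
  continuous (energy tau psi rho theta eta m).
Proof.
move=> mn; apply: continuous_potential => //.
by apply: smooth_derive => //; exact: dirs_theta.
Qed.

Let cB (f g : 'rV[R]_d -> R) : continuous f -> continuous g -> continuous (fun x => f x - g x).
Proof. by move=> cf cg x; exact: (cvgB (cf x) (cg x)). Qed.

Let cdr : continuous dr.
Proof. by have [_ c _] := VhB _ _ _ _ (Vh_rho n.+1 le_n1) (Vh_rho n le_n). Qed.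
Let cdt : continuous dt.
Proof. by have [_ c _] := VhB _ _ _ _ (proj1 (Vh_theta n.+1 le_n1)) (proj1 (Vh_theta n le_n)). Qed.
Let cde : continuous de.
Proof. by have [_ c _] := VhB _ _ _ _ (Vh_eta n.+1 le_n1) (Vh_eta n le_n). Qed.

Lemma continuous_theta_remainder : continuous theta_remainder.
Proof.
apply: continuous_funM; first exact: continuous_fun_cst.
apply: cB; first by apply: cB; exact: continuous_potential.
apply: continuous_funM => //; apply: continuous_potential => //.
exact: (smooth_derive psi dir_theta smooth_psi dirs_theta).
Qed.

Lemma continuous_rho_eta_remainder : continuous rho_eta_remainder.
Proof.
have sr f : smooth_potential f -> smooth_potential (d_rho f).
  by move=> sf; exact: (smooth_derive f dir_rho sf dirs_rho).
have se f : smooth_potential f -> smooth_potential (d_eta f).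
  by move=> sf; exact: (smooth_derive f dir_eta sf dirs_eta).
apply: cB; (apply: continuous_funM; first exact: continuous_fun_cst).
  apply: cB; first by apply: cB; exact: continuous_potential.
  by apply: continuous_funD; apply: continuous_funM => //;
    apply: continuous_potential => //; auto.
apply: continuous_funD; first by apply: cB; exact: continuous_potential.
by apply: continuous_funD; apply: continuous_funM => //;
  apply: continuous_potential => //; auto.
Qed.

Lemma theta_remainder_le0 x : theta_remainder x <= 0.
Proof.
have [_ cv _ _ _] := hpsi.
have := concave_theta_tangent psi (lev tau rho n x) (lev tau eta n x) _ _
  smooth_psi cv (theta_gt0 n x le_n) (theta_gt0 n.+1 x le_n1).
by rewrite /theta_remainder /dlev /state_at; lra.
Qed.

Lemma rho_eta_remainder_le0 x : rho_eta_remainder x <= 0.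
Proof.
have [_ _ _ [_ vex cav] _] := hpsi.
have Dv := is_derive_rho_eta psi_vex (st n.+1 x) (lev tau rho n x - lev tau rho n.+1 x)
  (lev tau eta n x - lev tau eta n.+1 x) smooth_vex (theta_gt0 n.+1 x le_n1).
have Dc := is_derive_rho_eta psi_cav (mixed x) (dr x) (de x)
  smooth_cav (theta_gt0 n.+1 x le_n1).
have := convex_rho_eta_tangent _ _ _ _ _ _ _ vex (theta_gt0 n.+1 x le_n1) Dv.
have := convex_rho_eta_tangent _ _ _ _ _ _ _ cav (theta_gt0 n.+1 x le_n1) (is_deriveN Dc).
rewrite /rho_eta_remainder /dlev /state_at.
move: (d_rho psi_vex _) (d_eta psi_vex _) (d_rho psi_cav _) (d_eta psi_cav _) => A B C D.
by move=> /=; nra.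
Qed.


(** What enters of the intermediate functions is that their defects are the remainders;
    integrability and signs are then read off from the continuous remainders. *)
Variables (xi1 chi1 chi2 chi3 chi4 : 'rV[R]_d -> R).
Hypothesis theta_defectE : forall x,
  theta_defect tau psi rho theta eta n xi1 x = theta_remainder x.
Hypothesis hessian_defectE : forall x,
  hessian_defect tau psi_vex psi_cav rho theta eta n chi1 chi2 chi3 chi4 x
  = rho_eta_remainder x.

Let funE1 : theta_defect tau psi rho theta eta n xi1 = theta_remainder.
Proof. exact/funext. Qed.

Let funE2 : hessian_defect tau psi_vex psi_cav rho theta eta n chi1 chi2 chi3 chi4
  = rho_eta_remainder.
Proof. exact/funext. Qed.

Lemma integrable_theta_defect :
  integrable_on (cube a l) (theta_defect tau psi rho theta eta n xi1).
Proof.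
by rewrite funE1; apply: integrable_continuous_cube; exact: continuous_theta_remainder.
Qed.

Lemma integrable_hessian_defect : integrable_on (cube a l)
  (hessian_defect tau psi_vex psi_cav rho theta eta n chi1 chi2 chi3 chi4).
Proof.
by rewrite funE2; apply: integrable_continuous_cube; exact: continuous_rho_eta_remainder.
Qed.

Let I_ge0 (f : 'rV[R]_d -> R) : (forall x, 0 <= f x) -> 0 <= I f.
Proof. by move=> f0; apply: Rintegral_ge0. Qed.

Let I_le0 (f : 'rV[R]_d -> R) : continuous f -> (forall x, f x <= 0) -> I f <= 0.
Proof.
move=> cf f0; rewrite -oppr_ge0 -mulN1r -(integral_scale_cells _ _ _ U)//.
  by apply: I_ge0 => x; rewrite mulN1r oppr_ge0.
exact: pwc_continuous.
Qed.

Lemma num_dissipation_ge0 : 0 <= num_dissipation a l tau gamma_rho gamma_eta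
  psi psi_vex psi_cav rho theta eta n xi1 chi1 chi2 chi3 chi4.
Proof.
rewrite /num_dissipation funE1 funE2 /ipv.
have h1 : 0 <= gamma_rho / 2 * I (fun x => dot (grad dr x) (grad dr x)).
  by rewrite mulr_ge0 ?divr_ge0 ?I_ge0 ?ltW// => x; exact: dot_ge0.
have h2 : 0 <= gamma_eta / 2 * I (fun x => dot (grad de x) (grad de x)).
  by rewrite mulr_ge0 ?divr_ge0 ?I_ge0 ?ltW// => x; exact: dot_ge0.
have h3 := I_le0 _ continuous_theta_remainder theta_remainder_le0.
have h4 := I_le0 _ continuous_rho_eta_remainder rho_eta_remainder_le0.
exact: num_dissipation_sign.
Qed.

Local Notation z := (mob_arg_at tau w_old w_new rho theta eta n).
Local Notation mr := (lev tau mu_rho n.+1).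
Local Notation me := (lev tau mu_eta n.+1).
Local Notation th := (lev tau theta n.+1).

Lemma dissipation_balance :
  dissipation a l tau L w_old w_new rho theta eta mu_rho mu_eta n =
  ipv a l (fun x => L11 L (z x) *m grad mr x - L12 L (z x) *m grad th x
                    + me x *: L13 L (z x)) (grad mr)
  - ipv a l (fun x => L12 L (z x) *m grad mr x - L22 L (z x) *m grad th x
                    + me x *: L23 L (z x)) (grad th)
  + ip a l (fun x => dot (L13 L (z x)) (grad mr x)
                     - dot (L23 L (z x)) (grad th x) + L33 L (z x) * me x) me.
Proof.
have Vth m : (m <= n.+1)%N -> Vh l T (lev tau theta m) by move=> /Vh_theta[].
have p11 := pwc_L11 hU _ _ _ _ hL w_old w_new _ _ _ _ Vh_rho Vth Vh_eta.
have p12 := pwc_L12 hU _ _ _ _ hL w_old w_new _ _ _ _ Vh_rho Vth Vh_eta.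
have p13 := pwc_L13 hU _ _ _ _ hL w_old w_new _ _ _ _ Vh_rho Vth Vh_eta.
have p22 := pwc_L22 hU _ _ _ _ hL w_old w_new _ _ _ _ Vh_rho Vth Vh_eta.
have p23 := pwc_L23 hU _ _ _ _ hL w_old w_new _ _ _ _ Vh_rho Vth Vh_eta.
have p33 := pwc_L33 hU _ _ _ _ hL w_old w_new _ _ _ _ Vh_rho Vth Vh_eta.
have gmr := pwc_mx_grad hU _ Vh_mu_rho.
have gth := pwc_mx_grad hU _ (Vth _ le_n1).
have pme := pwc_Vh _ _ U _ Vh_mu_eta.
pose A1 x := dot (L11 L (z x) *m grad mr x - L12 L (z x) *m grad th x
                    + me x *: L13 L (z x)) (grad mr x).
pose A2 x := dot (L12 L (z x) *m grad mr x - L22 L (z x) *m grad th x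
                    + me x *: L23 L (z x)) (grad th x).
pose A3 x := (dot (L13 L (z x)) (grad mr x)
                     - dot (L23 L (z x)) (grad th x) + L33 L (z x) * me x) * me x.
have pA1 : pwc A1.
  apply: pwc_dot => //; apply: pwc_mxD; last exact: pwc_mxZ.
  by apply: pwc_mxB; exact: pwc_mxM.
have pA2 : pwc A2.
  apply: pwc_dot => //; apply: pwc_mxD; last exact: pwc_mxZ.
  by apply: pwc_mxB; exact: pwc_mxM.
have pA3 : pwc A3.
  apply: pwcM => //; apply: pwcD; last exact: pwcM.
  by apply: pwcB; exact: pwc_dot.
rewrite /ip /ipv -/A1 -/A2 -/A3.
rewrite -(integral_sub_cells _ _ _ U hU)// -(integral_add_cells _ _ _ U hU)//; last exact: pwcB.
rewrite /dissipation; congr (I _); apply/funext => x.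
exact: dot_block_mx.
Qed.

Let pwc_entropy m : (m <= n.+1)%N ->
  pwc (entropy tau gamma_rho gamma_eta psi rho theta eta m).
Proof.
move=> mn.
have pt := pwc_Vh _ _ U _ (proj1 (Vh_theta m mn)).
have gr := pwc_mx_grad hU _ (Vh_rho m mn); have ge := pwc_mx_grad hU _ (Vh_eta m mn).
apply: pwcB; last by apply: pwcZ; exact: pwc_dot.
apply: pwcB; last by apply: pwcZ; exact: pwc_dot.
apply: pwcB; last exact: pwc_potential.
apply: pwcM => //; apply: pwc_continuous; exact: continuous_energy.
Qed.

Let quotient_relation (f g : 'rV[R]_d -> R) : continuous f -> continuous g ->
  ip a l (fun x => f x / tau) g = tau^-1 * I (fun x => g x * f x).
Proof.
move=> cf cg; rewrite -(integral_scale_cells _ _ _ U hU).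
  by congr (I _); apply/funext => x; ring.
by apply: pwc_continuous; exact: continuous_funM.
Qed.

Lemma entropy_step :
  ip a l (entropy tau gamma_rho gamma_eta psi rho theta eta n.+1) (fun=> 1) =
  ip a l (entropy tau gamma_rho gamma_eta psi rho theta eta n) (fun=> 1)
  + num_dissipation a l tau gamma_rho gamma_eta
      psi psi_vex psi_cav rho theta eta n xi1 chi1 chi2 chi3 chi4
  + tau * dissipation a l tau L w_old w_new rho theta eta mu_rho mu_eta n.
Proof.
have Vr1 := Vh_rho n.+1 le_n1; have Vr0 := Vh_rho n le_n.
have Ve1 := Vh_eta n.+1 le_n1; have Ve0 := Vh_eta n le_n.
have Vt1 := proj1 (Vh_theta n.+1 le_n1).
have Vdr : Vh l T dr by exact: VhB.
have Vde : Vh l T de by exact: VhB.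
have [_ cmr _] := Vh_mu_rho; have [_ cme _] := Vh_mu_eta; have [_ cth _] := Vt1.
pose en := energy tau psi rho theta eta.
have cden : continuous (fun x => en n.+1 x - en n x).
  by apply: cB; exact: continuous_energy.
have [S1 S2 S3 S4 S5] := step _ _ _ _ _ Vh_mu_rho Vdr Vt1 Vh_mu_eta Vde.
rewrite quotient_relation// in S1.
rewrite (quotient_relation (fun x => en n.+1 x - en n x))// in S3.
rewrite quotient_relation// in S4.
rewrite dissipation_balance.
pose P x := d_rho psi_vex (st n.+1 x) + d_rho psi_cav (mixed x).
pose Q x := d_eta psi_vex (st n.+1 x) + d_eta psi_cav (mixed x).
have pP : pwc P.
  apply: pwcD; apply: pwc_potential => //.
    exact: (smooth_derive psi_vex dir_rho smooth_vex dirs_rho).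
  exact: (smooth_derive psi_cav dir_rho smooth_cav dirs_rho).
have pQ : pwc Q.
  apply: pwcD; apply: pwc_potential => //.
    exact: (smooth_derive psi_vex dir_eta smooth_vex dirs_eta).
  exact: (smooth_derive psi_cav dir_eta smooth_cav dirs_eta).
pose s m := entropy tau gamma_rho gamma_eta psi rho theta eta m.
have pdr := pwc_continuous T U _ cdr; have pde := pwc_continuous T U _ cde.
have g1 := pwc_mx_grad hU _ Vr1; have g2 := pwc_mx_grad hU _ Vdr.
have g3 := pwc_mx_grad hU _ Ve1; have g4 := pwc_mx_grad hU _ Vde.
(* The order of the terms is that of the long equation in [entropy_step_algebra]. *)
pose terms : seq (R * ('rV[R]_d -> R)) :=
  [:: (1, fun x => s n.+1 x * 1); (- 1, fun x => s n x * 1);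
      (- (gamma_rho / 2), fun x => dot (grad dr x) (grad dr x));
      (- (gamma_eta / 2), fun x => dot (grad de x) (grad de x));
      (1 / 2, theta_remainder); (1 / 2, rho_eta_remainder);
      (- 1, fun x => th x * (en n.+1 x - en n x));
      (gamma_rho, fun x => dot (grad (lev tau rho n.+1) x) (grad dr x));
      (gamma_eta, fun x => dot (grad (lev tau eta n.+1) x) (grad de x));
      (1, fun x => P x * dr x); (1, fun x => Q x * de x)].
have pterms : foldr (fun p P => pwc p.2 /\ P) True terms.
do 2 (split; first by apply: pwcM; [exact: pwc_entropy|exact: pwc_cst]).
  do 2 (split; first exact: pwc_dot).
  split; first by apply: pwc_continuous; exact: continuous_theta_remainder.
  split; first by apply: pwc_continuous; exact: continuous_rho_eta_remainder.
  split; first by apply: pwc_continuous; exact: continuous_funM.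
  do 2 (split; first exact: pwc_dot).
  by do 2 (split; first exact: pwcM).
(* The gradient terms cancel by the polarization identity: with [G1], [G0] the new and old
   gradients, the product of [G1] with [G1 - G0] is half of [|G1|^2 - |G0|^2 + |G1 - G0|^2]. *)
have sum0 K x : U K x -> \sum_(p <- terms) p.1 * p.2 x = 0.
  move=> Ux; rewrite /terms !big_cons big_nil /=.
  have -> : grad dr x = grad (lev tau rho n.+1) x - grad (lev tau rho n) x.
    exact: (Vh_gradB a l T U hU _ _ K x Vr1 Vr0 Ux).
  have -> : grad de x = grad (lev tau eta n.+1) x - grad (lev tau eta n) x.
    exact: (Vh_gradB a l T U hU _ _ K x Ve1 Ve0 Ux).
  have [_ _ _ [dec _ _] _] := hpsi.
  rewrite /s /entropy /theta_remainder /rho_eta_remainder /en /energy /P /Q.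
  (* The splitting of [psi] is inserted at the two ends of the [(rho, eta)] move only; the [theta]
     move uses [psi] itself. *)
  rewrite (dec (st n.+1 x)); last exact: theta_gt0.
  rewrite (dec (mixed x)); last exact: theta_gt0.
  rewrite /dlev.
  move: (grad (lev tau rho n.+1) x) (grad (lev tau rho n) x)
    (grad (lev tau eta n.+1) x) (grad (lev tau eta n) x) => G1 G0 N1 N0.
  rewrite !dotDl !dotDr !dotNl !dotNr (dotC G0 G1) (dotC N0 N1).
  rewrite /state_at /=.
  move: (psi _) (psi_vex _) (psi_vex _) (psi_cav _) (psi_cav _) (d_theta psi _)
    (d_theta psi _) (d_rho psi_vex _) (d_rho psi_cav _) (d_eta psi_vex _)
    (d_eta psi_cav _).
  move: (lev tau rho n.+1 x) (lev tau rho n x) (lev tau theta n.+1 x)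
    (lev tau theta n x) (lev tau eta n.+1 x) (lev tau eta n x).
  move: (dot _ _) (dot _ _) (dot _ _) (dot _ _) (dot _ _) (dot _ _).
  by move=> *; field.
have := integral_linear_relation hU terms pterms sum0.
rewrite /terms !big_cons big_nil /= => REL.
rewrite /num_dissipation funE1 funE2.
exact: (entropy_step_algebra _ _ _ _ _ _ _ _ _ _ _ _ _ _ _ _ _ _ _ _ tau_neq0 REL S1 S2 S3 S4 S5).
Qed.

End EntropyStep.

(** * Summation over the time steps *)

Lemma eq_first_of_steps (V : Type) (N : nat) (u : nat -> V) :
  (forall n, (n < N)%N -> u n.+1 = u n) ->
  forall n, (n < N)%N -> u n.+1 = u 0%N.
Proof.
move=> H; elim=> [|n IH] nN; first exact: H.
by rewrite H// IH// ltnW.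
Qed.

Lemma sum_of_steps (R : comNzRingType) (N : nat) (c : R) (u v w : nat -> R) :
  (forall n, (n < N)%N -> u n.+1 = u n + v n + c * w n) ->
  forall n, (n < N)%N -> u n.+1 =
    u 0%N + \sum_(0 <= k < n.+1) v k + c * \sum_(0 <= k < n.+1) w k.
Proof.
move=> H; elim=> [|n IH] nN; first by rewrite !big_nat1 H.
rewrite H// IH ?(ltnW nN)// ![in RHS](@big_nat_recr _ _ _ n.+1)//=; ring.
Qed.

Theorem lemma11 (R : realType) (d : nat) (hd : d = 2%N \/ d = 3%N)
  (a : 'rV[R]_d) (l : R) (hl : 0 < l)
  (Th : @mesh R d) (hTh : conforming_periodic_triangulation a l Th)
  (T tau : R) (hT : 0 < T) (htau : 0 < tau)
  (nT : nat) (hnT : nT%:R = T / tau)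
  (gamma_rho gamma_eta : R) (hgr : 0 < gamma_rho) (hge : 0 < gamma_eta)
  (L : @mobility R d) (lam0 lam1 : R) (hL : admissible_mobility L lam0 lam1)
  (w_old w_new : 'I_5 -> R)
  (psi psi_vex psi_cav : @state R -> R)
  (hpsi : admissible_potential psi psi_vex psi_cav)
  (rho0 theta0 eta0 : 'rV[R]_d -> R)
  (rho theta eta mu_rho mu_eta : R -> 'rV[R]_d -> R)
  (hsol : discrete_solution a l Th tau gamma_rho gamma_eta
            psi psi_vex psi_cav L w_old w_new rho theta eta mu_rho mu_eta
            nT rho0 theta0 eta0) :
  let one := fun _ : 'rV[R]_d => 1 : R in
  let e := energy tau psi rho theta eta in
  let s := entropy tau gamma_rho gamma_eta psi rho theta eta in
  let D_num := num_dissipation a l tau gamma_rho gamma_eta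
                 psi psi_vex psi_cav rho theta eta in
  let D_L := dissipation a l tau L w_old w_new rho theta eta mu_rho mu_eta in
  (forall n, (n < nT)%N ->
     ip a l (lev tau rho n.+1) one = ip a l (lev tau rho 0) one /\
     ip a l (e n.+1) one = ip a l (e 0%N) one) /\
  exists xi1 chi1 chi2 chi3 chi4 : nat -> 'rV[R]_d -> R,
    forall n, (n < nT)%N ->
      [/\ intermediate a l tau psi psi_vex psi_cav rho theta eta n
            (xi1 n) (chi1 n) (chi2 n) (chi3 n) (chi4 n),
          0 <= D_num n (xi1 n) (chi1 n) (chi2 n) (chi3 n) (chi4 n) &
          ip a l (s n.+1) one =
            ip a l (s 0%N) one
            + \sum_(0 <= k < n.+1)
                D_num k (xi1 k) (chi1 k) (chi2 k) (chi3 k) (chi4 k)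
            + tau * \sum_(0 <= k < n.+1) D_L k].
Proof.
move=> one e s D_num D_L.
have d_gt0 : (0 < d)%N by case: hd => ->.
have [U hU] := open_cells_exist a l Th d_gt0 hTh.
have [[[Prho _] [Ptheta _] [Peta _]] [[Pmr _] [Pme _]] _ _ Hstep] := hsol.
have grid m : (m <= nT)%N -> 0 <= m%:R * tau <= nT%:R * tau.
  by move=> mn; rewrite mulr_ge0/= ?ler_wpM2r ?ler_nat// ltW.
have Vrho m : (m <= nT)%N -> Vh l Th (lev tau rho m) by move=> /grid /Prho.
have Vtheta m : (m <= nT)%N -> Vh_pos a l Th (lev tau theta m) by move=> /grid /Ptheta.
have Veta m : (m <= nT)%N -> Vh l Th (lev tau eta m) by move=> /grid /Peta.
(* The chemical potentials are known to lie in [Vh] at positive times only, hence the strict lower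
   bound and the index [n.+1]. *)
have gridS n : (n < nT)%N -> 0 < n.+1%:R * tau <= nT%:R * tau.
  by move=> nn; rewrite mulr_gt0//= ler_wpM2r ?ler_nat// ltW.
have Vmr n : (n < nT)%N -> Vh l Th (lev tau mu_rho n.+1) by move=> /gridS /Pmr.
have Vme n : (n < nT)%N -> Vh l Th (lev tau mu_eta n.+1) by move=> /gridS /Pme.
have tau0 : tau != 0 by rewrite gt_eqF.
have upto n m : (n < nT)%N -> (m <= n.+1)%N -> (m <= nT)%N.
  by move=> nn mn; apply: leq_trans mn nn.
have mass n : (n < nT)%N -> ip a l (lev tau rho n.+1) one = ip a l (lev tau rho n) one.
  move=> nn; have Vone : Vh l Th one by exact: Vh_cst.
  have [S1 _ _ _ _] := Hstep n nn one one one one one Vone Vone Vone Vone Vone.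
  have [_ c1 _] := Vrho n.+1 nn; have [_ c0 _] := Vrho n (ltnW nn).
  exact: (conserved_integral hU _ _ _ _ tau0 c0 c1 S1).
have heat n : (n < nT)%N -> ip a l (e n.+1) one = ip a l (e n) one.
  move=> nn; have Vone : Vh l Th one by exact: Vh_cst.
  have [_ _ S3 _ _] := Hstep n nn one one one one one Vone Vone Vone Vone Vone.
  have ce := continuous_energy tau psi psi_vex psi_cav rho theta eta n hl hpsi
    (fun m mn => Vrho m (upto n m nn mn)) (fun m mn => Vtheta m (upto n m nn mn))
    (fun m mn => Veta m (upto n m nn mn)).
  exact: (conserved_integral hU _ _ _ _ tau0 (ce n (leqnSn n)) (ce n.+1 (leqnn _)) S3).
split.
  move=> n nn; split.
    exact: (eq_first_of_steps _ _ (fun m => ip a l (lev tau rho m) one) mass n nn).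
  exact: (eq_first_of_steps _ _ (fun m => ip a l (e m) one) heat n nn).
(* All five values are chosen at once over pairs of a time step and a point; the condition on the
   step sits inside, and zeros serve beyond the last step. *)
have /choice[f fP] : forall p : nat * 'rV[R]_d, exists q : R * R * R * R * R,
    (p.1 < nT)%N ->
  let: (n, x) := p in let: (xi, chi1, chi2, chi3, chi4) := q in
  [/\ between (lev tau theta n x) (lev tau theta n.+1 x) xi,
      between (lev tau rho n x) (lev tau rho n.+1 x) chi1 /\
        between (lev tau rho n x) (lev tau rho n.+1 x) chi3,
      between (lev tau eta n x) (lev tau eta n.+1 x) chi2 /\
        between (lev tau eta n x) (lev tau eta n.+1 x) chi4,
      theta_defect tau psi rho theta eta n (fun=> xi) x
        = theta_remainder tau psi rho theta eta n x &
      hessian_defect tau psi_vex psi_cav rho theta eta n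
        (fun=> chi1) (fun=> chi2) (fun=> chi3) (fun=> chi4) x
      = rho_eta_remainder tau psi_vex psi_cav rho theta eta n x].
  case=> n x /=; case: (ltnP n nT) => nn; last by exists (0, 0, 0, 0, 0).
  have [xi [c1 [c2 [c3 [c4 H]]]]] := intermediate_values tau psi psi_vex psi_cav rho theta eta n hl hpsi
    (fun m mn => Vtheta m (upto n m nn mn)) x.
  by exists (xi, c1, c2, c3, c4).
pose xi1 n x := (f (n, x)).1.1.1.1; pose chi1 n x := (f (n, x)).1.1.1.2.
pose chi2 n x := (f (n, x)).1.1.2; pose chi3 n x := (f (n, x)).1.2.
pose chi4 n x := (f (n, x)).2.
exists xi1, chi1, chi2, chi3, chi4.
have {}fP n x : (n < nT)%N ->
  [/\ between (lev tau theta n x) (lev tau theta n.+1 x) (xi1 n x),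
      between (lev tau rho n x) (lev tau rho n.+1 x) (chi1 n x) /\
        between (lev tau rho n x) (lev tau rho n.+1 x) (chi3 n x),
      between (lev tau eta n x) (lev tau eta n.+1 x) (chi2 n x) /\
        between (lev tau eta n x) (lev tau eta n.+1 x) (chi4 n x),
      theta_defect tau psi rho theta eta n (xi1 n) x
        = theta_remainder tau psi rho theta eta n x &
      hessian_defect tau psi_vex psi_cav rho theta eta n
        (chi1 n) (chi2 n) (chi3 n) (chi4 n) x
      = rho_eta_remainder tau psi_vex psi_cav rho theta eta n x].
  move=> /(fP (n, x)); rewrite /theta_defect /hessian_defect /xi1 /chi1 /chi2 /chi3 /chi4.
  by case: (f (n, x)) => -[[[? ?] ?] ?] ?.
have tdE n (nn : (n < nT)%N) x : theta_defect tau psi rho theta eta n (xi1 n) x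
    = theta_remainder tau psi rho theta eta n x by have [] := fP n x nn.
have hdE n (nn : (n < nT)%N) x : hessian_defect tau psi_vex psi_cav rho theta eta n
        (chi1 n) (chi2 n) (chi3 n) (chi4 n) x
      = rho_eta_remainder tau psi_vex psi_cav rho theta eta n x
  by have [] := fP n x nn.
have balance n : (n < nT)%N -> ip a l (s n.+1) one = ip a l (s n) one
    + D_num n (xi1 n) (chi1 n) (chi2 n) (chi3 n) (chi4 n) + tau * D_L n.
  move=> nn.
  exact: (entropy_step hU tau gamma_rho gamma_eta psi psi_vex psi_cav L lam0 lam1
    w_old w_new rho theta eta mu_rho mu_eta n hl tau0 hL hpsi
    (fun m mn => Vrho m (upto n m nn mn)) (fun m mn => Vtheta m (upto n m nn mn))
    (fun m mn => Veta m (upto n m nn mn)) (Vmr n nn) (Vme n nn) (Hstep n nn)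
    _ _ _ _ _ (tdE n nn) (hdE n nn)).
move=> n nn; split.
- split; [by move=> x _; have [] := fP n x nn|by move=> x _; have [] := fP n x nn|
    by move=> x _; have [] := fP n x nn| |].
  + exact: (integrable_theta_defect tau psi psi_vex psi_cav rho theta eta n hl hpsi
      (fun m mn => Vrho m (upto n m nn mn)) (fun m mn => Vtheta m (upto n m nn mn))
      (fun m mn => Veta m (upto n m nn mn)) _ (tdE n nn)).
  + exact: (integrable_hessian_defect tau psi psi_vex psi_cav rho theta eta n hl hpsi
      (fun m mn => Vrho m (upto n m nn mn)) (fun m mn => Vtheta m (upto n m nn mn))
      (fun m mn => Veta m (upto n m nn mn)) _ _ _ _ (hdE n nn)).
- exact: (num_dissipation_ge0 hU tau gamma_rho gamma_eta psi psi_vex psi_cav rho theta eta n hl hgr hge hpsi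
      (fun m mn => Vrho m (upto n m nn mn)) (fun m mn => Vtheta m (upto n m nn mn))
      (fun m mn => Veta m (upto n m nn mn)) _ _ _ _ _ (tdE n nn) (hdE n nn)).
- exact: (sum_of_steps _ _ _ (fun m => ip a l (s m) one)
    (fun k => D_num k (xi1 k) (chi1 k) (chi2 k) (chi3 k) (chi4 k)) D_L balance n nn).
Qed.
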